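(* Let $\Delta_n\downarrow0$, $n\Delta_n\to\infty$, $L_n=\log(1/\Delta_n)$, $\sigma>0$, $\alpha>0$, $\vartheta_{\mathrm m}=(\sigma,3/4)$, $\vartheta_{\mathrm o}=(\sigma,3/4,\alpha)$. Assume the critical LAN expansions in the mfBm and mfOU models: for $\bullet\in\{\mathrm m,\mathrm o\}$ and every fixed $h$ ($h\in\mathbb R^2$ if $\bullet=\mathrm m$, $h\in\mathbb R^3$ if $\bullet=\mathrm o$), $$\ell_n^{\bullet}(\vartheta_{\bullet}+r_{n,\bullet}^{-1}h)-\ell_n^{\bullet}(\vartheta_{\bullet})=h^\top\Xi_n^{\bullet}-\tfrac12h^\top\Gamma_{\bullet}^{\mathrm{crit}}h+o_{P_{\vartheta_\bullet}}(1),\qquad \Xi_n^\bullet\xrightarrow{d}\mathcal N(0,\Gamma_\bullet^{\mathrm{crit}})\ \text{under }P_{\vartheta_\bullet}.$$ Let $$T_n^{\bullet}=\frac{8}{\sqrt3\,\sigma^2}\Bigl(\Xi_{H,n}^{\bullet}-\frac{\sigma}{2}\,\Xi_{\sigma,n}^{\bullet}\Bigr),\qquad I_H^{\mathrm{eff},\bullet}=\frac{3\sigma^4}{64}.$$ Under the critical null hypothesis $H=3/4$ (law $P_{\vartheta_\bullet}$), $$T_n^{\mathrm m}\xrightarrow{d}\mathcal N(0,1),\qquad T_n^{\mathrm o}\xrightarrow{d}\mathcal N(0,1).$$ Under local alternatives with parameter $\vartheta_\bullet+r_{n,\bullet}^{-1}h$ with positive $H$-component, namely $h=(\cdot,h_H)$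 in the mfBm case and $h=(\cdot,h_H,\cdot)$ in the mfOU case with $h_H>0$, $$T_n^{\mathrm m}\xrightarrow{d}\mathcal N\bigl(h_H\sqrt{I_H^{\mathrm{eff},\mathrm m}},1\bigr),\qquad T_n^{\mathrm o}\xrightarrow{d}\mathcal N\bigl(h_H\sqrt{I_H^{\mathrm{eff},\mathrm o}},1\bigr).$$ Consequently, for $a\in(0,1)$, an asymptotic level-$a$ boundary-calibrated (i.e. with critical value calibrated at $H=3/4$) one-sided test of $H_0:H\le 3/4$ versus $H_1:H>3/4$ rejects for large values of the statistic, that is, whenever $T_n^{\mathrm m}>z_{1-a}$ or $T_n^{\mathrm o}>z_{1-a}$, according to the model under consideration, where $z_p=\Phi^{-1}(p)$ is the standard normal $p$-quantile.
   Context: mfBm model ($\bullet=\mathrm m$): $Y_t=\sigma B_t^H+W_t$, with $B^H$ a standard fractional Brownian motion of Hurst index $H$ and $W$ an independent standard Brownian motion; the data are the increments $X_n^{\mathrm m}=(Y_{k\Delta_n}-Y_{(k-1)\Delta_n})_{k=1}^n$, centered Gaussian with covariance $\Sigma_n^{\mathrm m}(\sigma,H)$. mfOU model ($\bullet=\mathrm o$): $X$ is the stationary solution of $dX_t=-\alpha X_t\,dt+d(\sigma B_t^H+W_t)$; the data are $X_n^{\mathrm o}=(X_{\Delta_n},\dots,X_{n\Delta_n})^\top$, centered Gaussian with covariance $\Sigma_n^{\mathrm o}(\sigma,H,\alpha)$. $\ell_n^\bullet$ is the Gaussian log-likelihood, $P_\theta$ the law with parameter $\theta$, and $S_{i,n}^\bullet=\partial_i\ell_n^\bullet$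 evaluated at the critical point $\vartheta_\bullet$. The transformed $H$-score is $R_{H,n}^\bullet=S_{H,n}^\bullet+\sigma L_nS_{\sigma,n}^\bullet$. Normalized scores: $\Xi_{\sigma,n}^\bullet=S_{\sigma,n}^\bullet/\sqrt{n\Delta_nL_n}$, $\Xi_{H,n}^\bullet=R_{H,n}^\bullet/(\sqrt{n\Delta_n}\,L_n^{3/2})$, $\Xi_{\alpha,n}^{\mathrm o}=S_{\alpha,n}^{\mathrm o}/\sqrt{n\Delta_n}$; $\Xi_n^{\mathrm m}=(\Xi_{\sigma,n}^{\mathrm m},\Xi_{H,n}^{\mathrm m})^\top$, $\Xi_n^{\mathrm o}=(\Xi_{\sigma,n}^{\mathrm o},\Xi_{H,n}^{\mathrm o},\Xi_{\alpha,n}^{\mathrm o})^\top$. Rate matrices: $$r_{n,\mathrm m}^{-1}=\begin{pmatrix}(n\Delta_nL_n)^{-1/2}&\sigma(n\Delta_nL_n)^{-1/2}\\ 0&(n\Delta_n)^{-1/2}L_n^{-3/2}\end{pmatrix},\quad r_{n,\mathrm o}^{-1}=\begin{pmatrix}r_{n,\mathrm m}^{-1}&0\\0&(n\Delta_n)^{-1/2}\end{pmatrix}.$$ Information matrices: $$\Gamma_{\mathrm m}^{\mathrm{crit}}=\begin{pmatrix}\frac{9\sigma^2}{16}&\frac{9\sigma^3}{32}\\[2pt] \frac{9\sigma^3}{32}&\frac{3\sigma^4}{16}\end{pmatrix},\qquad \Gamma_{\mathrm o}^{\mathrm{crit}}=\begin{pmatrix}\Gamma_{\mathrm m}^{\mathrm{crit}}&0\\0&\frac1{2\alpha}\end{pmatrix}.$$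 $I_H^{\mathrm{eff},\bullet}$ is the efficient information, i.e. the Schur complement of the nuisance block ($\sigma$ for mfBm, $(\sigma,\alpha)$ for mfOU) in $\Gamma_\bullet^{\mathrm{crit}}$, equal to $3\sigma^4/64$. *)

(* Defs.v *)
From HB Require Import structures.
From mathcomp Require Export all_boot all_order all_algebra.
From mathcomp Require Export all_classical all_reals all_analysis.
Export Order.TTheory GRing.Theory Num.Theory.
Export numFieldNormedType.Exports.

Set Implicit Arguments.
Unset Strict Implicit.
Unset Printing Implicit Defensive.

Global Open Scope classical_set_scope.
Global Open Scope ring_scope.

Section GaussianVectors.
Context {R : realType}.

(* Lebesgue integral over R^n, as an iterated integral. *)
Fixpoint integral_Rn (n : nat) : (n.-tuple R -> \bar R) -> \bar R :=
  match n with
  | 0 => fun f => f [tuple]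
  | m.+1 => fun f =>
      (\int[lebesgue_measure]_x integral_Rn (fun t : m.-tuple R => f [tuple of x :: t]))%E
  end.

Definition col_of_tuple (n : nat) (x : n.-tuple R) : 'cV[R]_n := \col_i tnth x i.

(* Log-density of N(0, S) on R^n for a nonsingular covariance matrix S. *)
Definition gauss_logpdf (n : nat) (S : 'M[R]_n) (x : 'cV[R]_n) : R :=
  - (n%:R / 2) * ln (2 * pi) - ln (\det S) / 2
  - (x^T *m invmx S *m x) 0 0 / 2.

Definition gauss_integral_Rn (n : nat) (S : 'M[R]_n) (f : 'cV[R]_n -> R) : \bar R :=
  integral_Rn (fun x : n.-tuple R =>
    (f (col_of_tuple x) * expR (gauss_logpdf S (col_of_tuple x)))%:E).

(* The law of the random vector X is N(0, S), S nonsingular. *)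
Definition gaussian_vector d (T : measurableType d) (P : probability T R)
    (n : nat) (S : 'M[R]_n) (X : T -> n.-tuple R) : Prop :=
  forall A : set (n.-tuple R), measurable A ->
    P (X @^-1` A) = integral_Rn (fun x : n.-tuple R =>
      (\1_A x * expR (gauss_logpdf S (col_of_tuple x)))%:E).

(* N(0, v) on the line, including the degenerate case v = 0, where
   [normal_prob 0 0] would not be the Dirac mass. *)
Definition normal_var (v : R) (A : set R) : \bar R :=
  if v == 0 then \d_(0 : R) A else normal_prob 0 (Num.sqrt v) A.

Definition std_normal_cdf (z : R) : R := fine (normal_prob 0 1 `]-oo, z]).

(* Phi^{-1}(p), for 0 < p < 1. *)
Definition std_normal_quantile (p : R) : R :=
  xget 0 [set z | std_normal_cdf z = p].

End GaussianVectors.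

Section Convergence.
Context {R : realType} {d : measure_display} {T : measurableType d}.

Definition bounded_continuous (V : topologicalType) (f : V -> R) : Prop :=
  continuous f /\ exists M : R, forall x, `|f x| <= M.

(* Under P_n, the random variable X_n converges in distribution to N(m, s^2). *)
Definition cvg_normal (P : nat -> probability T R) (X : nat -> T -> R)
    (m s : R) : Prop :=
  (forall n, measurable_fun setT (X n)) /\
  forall f : R -> R, bounded_continuous f ->
    (fun n => \int[P n]_w (f (X n w))%:E)%E @ \oo -->
    (\int[normal_prob m s]_x (f x)%:E)%E.

(* Under P_n, the random vector X_n converges in distribution to N(0, S), for a
   positive definite S. *)
Definition cvg_gaussian (P : nat -> probability T R) (k : nat)
    (X : nat -> T -> 'cV[R]_k) (S : 'M[R]_k) : Prop :=
  (forall n i, measurable_fun setT (fun w => X n w i 0)) /\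
  forall f : 'cV[R]_k -> R, bounded_continuous f ->
    (fun n => \int[P n]_w (f (X n w))%:E)%E @ \oo --> gauss_integral_Rn S f.

(* Z_n = o_P(1) *)
Definition small_o_proba (P : probability T R) (Z : nat -> T -> R) : Prop :=
  forall e : R, 0 < e ->
    (fun n => P [set w | e < `|Z n w|]) @ \oo --> 0%E.

End Convergence.

(* Processes are indexed by R, but only times t >= 0 matter. *)
Section Processes.
Context {R : realType} {d : measure_display} {T : measurableType d}.
Variable P : probability T R.
Implicit Types B W X Y Z : R -> {mfun T >-> R}.

Definition centered_gaussian_process (K : R -> R -> R) Z : Prop :=
  forall (m : nat) (t c : 'I_m -> R), (forall i, 0 <= t i) ->
    forall A : set R, measurable A ->
      P [set w | A (\sum_(i < m) c i * Z (t i) w)]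
      = normal_var (\sum_(i < m) \sum_(j < m) c i * c j * K (t i) (t j)) A.

Definition continuous_paths Z : Prop :=
  {ae P, forall w, {within `[0, +oo[, continuous (fun t => Z t w)}}.

Definition fbm_cov (H s t : R) : R :=
  (s `^ (2 * H) + t `^ (2 * H) - `|t - s| `^ (2 * H)) / 2.

Definition standard_fbm (H : R) B : Prop :=
  centered_gaussian_process (fbm_cov H) B /\ continuous_paths B.

Definition standard_bm W : Prop :=
  centered_gaussian_process (fun s t => Num.min s t) W /\ continuous_paths W.

Definition independent_processes B W : Prop :=
  forall (m k : nat) (s : 'I_m -> R) (t : 'I_k -> R)
         (A : 'I_m -> set R) (C : 'I_k -> set R),
    (forall i, 0 <= s i) -> (forall j, 0 <= t j) ->
    (forall i, measurable (A i)) -> (forall j, measurable (C j)) ->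
    let EB := [set w | forall i, A i (B (s i) w)] in
    let EW := [set w | forall j, C j (W (t j) w)] in
    P (EB `&` EW) = (P EB * P EW)%E.

Definition mixed_noise (H : R) B W : Prop :=
  [/\ standard_fbm H B, standard_bm W & independent_processes B W].

Definition is_mfBm (sigma H : R) Y : Prop :=
  exists B W, mixed_noise H B W /\
    {ae P, forall w, forall t, 0 <= t -> Y t w = sigma * B t w + W t w}.

Definition stationary_process X : Prop :=
  forall (m : nat) (u : R) (t : 'I_m -> R) (A : 'I_m -> set R),
    0 <= u -> (forall i, 0 <= t i) -> (forall i, measurable (A i)) ->
    P [set w | forall i, A i (X (u + t i) w)]
    = P [set w | forall i, A i (X (t i) w)].

(* dX_t = - alpha X_t dt + d(sigma B_t + W_t) in integrated form, on [0, +oo[.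
   For alpha > 0, two solutions driven by the same noise differ by a multiple
   of exp(- alpha t), hence stationarity determines the law of X. *)
Definition is_mfOU (sigma H alpha : R) X : Prop :=
  exists B W, [/\ mixed_noise H B W, continuous_paths X, stationary_process X &
    {ae P, forall w, forall t, 0 <= t ->
      X t w = X 0 w - alpha * (\int[lebesgue_measure]_(s in `[0, t]) X s w)
              + (sigma * B t w + W t w)}].

Definition covariance_mx (n : nat) (D : T -> n.-tuple R) : 'M[R]_n :=
  \matrix_(i, j) fine (covariance P (fun w => tnth (D w) i) (fun w => tnth (D w) j)).

End Processes.

Section Data.
Context {R : realType} {d : measure_display} {T : measurableType d}.
Variable Delta : nat -> R.

Definition mfBm_data (Y : R -> {mfun T >-> R}) (n : nat) (w : T) : n.-tuple R :=
  [tuple Y (k.+1%:R * Delta n) w - Y (k%:R * Delta n) w | k < n].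

Definition mfOU_data (X : R -> {mfun T >-> R}) (n : nat) (w : T) : n.-tuple R :=
  [tuple X (k.+1%:R * Delta n) w | k < n].

End Data.

(* Parameters are column vectors (sigma, H)^T or (sigma, H, alpha)^T: in both
   models coordinate 0 is sigma and coordinate 1 is H. *)
Section Experiment.
Context {R : realType} {d : measure_display} {T : measurableType d} {p : nat}.
Variable Delta : nat -> R.
Variable P : 'cV[R]_p.+2 -> probability T R.
Variable D : forall n : nat, T -> n.-tuple R.
Variable theta0 : 'cV[R]_p.+2.

Definition logstep (n : nat) : R := ln ((Delta n)^-1).

Definition loglik (n : nat) (theta : 'cV[R]_p.+2) (w : T) : R :=
  gauss_logpdf (covariance_mx (P theta) (@D n)) (col_of_tuple (D n w)).

Definition score (i : 'I_p.+2) (n : nat) (w : T) : R :=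
  'D_(delta_mx i 0 : 'cV[R]_p.+2) (fun theta => loglik n theta w) theta0.

Definition scoreRH (n : nat) (w : T) : R :=
  score 1 n w + theta0 0 0 * logstep n * score 0 n w.

Definition Xi_sigma (n : nat) (w : T) : R :=
  score 0 n w / Num.sqrt (n%:R * Delta n * logstep n).

Definition Xi_H (n : nat) (w : T) : R :=
  scoreRH n w / (Num.sqrt (n%:R * Delta n) * logstep n `^ (3 / 2)).

Definition Tstat (n : nat) (w : T) : R :=
  8 / (Num.sqrt 3 * theta0 0 0 ^+ 2)
  * (Xi_H n w - theta0 0 0 / 2 * Xi_sigma n w).

Definition local_param (rinv : nat -> 'M[R]_p.+2) (h : 'cV[R]_p.+2) (n : nat) :
  'cV[R]_p.+2 := theta0 + rinv n *m h.

Definition LAN (rinv : nat -> 'M[R]_p.+2) (Xi : nat -> T -> 'cV[R]_p.+2)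
    (Gamma : 'M[R]_p.+2) : Prop :=
  (forall h : 'cV[R]_p.+2,
     small_o_proba (P theta0) (fun n w =>
       loglik n (local_param rinv h n) w - loglik n theta0 w
       - ((h^T *m Xi n w) 0 0 - (h^T *m Gamma *m h) 0 0 / 2)))
  /\ cvg_gaussian (fun=> P theta0) Xi Gamma.

(* The test rejecting when T_n > z has asymptotic rejection probability a at the
   boundary point theta0 of the null hypothesis, and a limiting rejection
   probability larger than a under local alternatives with increased H. *)
Definition one_sided_test (rinv : nat -> 'M[R]_p.+2) (S : nat -> T -> R)
    (z a : R) : Prop :=
  (fun n => P theta0 [set w | z < S n w]) @ \oo --> a%:E /\
  forall h : 'cV[R]_p.+2, 0 < h 1 0 -> exists2 b : R, a < b &
    (fun n => P (local_param rinv h n) [set w | z < S n w]) @ \oo --> b%:E.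

End Experiment.

Section Models.
Context {R : realType}.

Definition mx2 (a b c e : R) : 'M[R]_2 :=
  block_mx (a%:M : 'M[R]_1) (b%:M : 'M[R]_1) (c%:M : 'M[R]_1) (e%:M : 'M[R]_1).

Definition cvec2 (a b : R) : 'cV[R]_2 := col_mx (a%:M : 'M[R]_1) (b%:M : 'M[R]_1).

Definition cvec3 (a b c : R) : 'cV[R]_3 := col_mx (cvec2 a b) (c%:M : 'M[R]_1).

Definition Gamma_m (sigma : R) : 'M[R]_2 :=
  mx2 (9 * sigma ^+ 2 / 16)  (9 * sigma ^+ 3 / 32)
      (9 * sigma ^+ 3 / 32)  (3 * sigma ^+ 4 / 16).

Definition Gamma_o (sigma alpha : R) : 'M[R]_3 :=
  block_mx (Gamma_m sigma) 0 0 ((1 / (2 * alpha))%:M : 'M[R]_1).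

Definition rinv_m (Delta : nat -> R) (sigma : R) (n : nat) : 'M[R]_2 :=
  let L := logstep Delta n in
  let a := (Num.sqrt (n%:R * Delta n * L))^-1 in
  mx2 a (sigma * a)
      0 ((Num.sqrt (n%:R * Delta n))^-1 * (L `^ (3 / 2))^-1).

Definition rinv_o (Delta : nat -> R) (sigma : R) (n : nat) : 'M[R]_3 :=
  block_mx (rinv_m Delta sigma n) 0
           0 ((Num.sqrt (n%:R * Delta n))^-1%:M : 'M[R]_1).

(* Efficient information for coordinate i: Schur complement of the block of
   all the other coordinates. *)
Definition efficient_info (k : nat) (G : 'M[R]_k.+1) (i : 'I_k.+1) : R :=
  G i i - (col' i (row i G) *m invmx (row' i (col' i G)) *m row' i (col i G)) 0 0.

Definition param_m : set 'cV[R]_2 :=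
  [set th | 0 < th 0 0 /\ 0 < th 1 0 < 1].

Definition param_o : set 'cV[R]_3 :=
  [set th | [/\ 0 < th 0 0, 0 < th 1 0 < 1 & 0 < th 2 0]].

Context {d : measure_display} {T : measurableType d}.

(* The second conjuncts record that the observed data are centered Gaussian with
   nonsingular covariance, so that the Gaussian log-likelihood is the log-density
   of their law; when Delta n > 0 this follows from the first conjuncts. *)
Definition mfBm_model (Delta : nat -> R) (P : 'cV[R]_2 -> probability T R)
    (Y : R -> {mfun T >-> R}) : Prop :=
  forall th, param_m th ->
    is_mfBm (P th) (th 0 0) (th 1 0) Y /\
    forall n, gaussian_vector (P th)
      (covariance_mx (P th) (mfBm_data Delta Y n)) (mfBm_data Delta Y n).

Definition mfOU_model (Delta : nat -> R) (P : 'cV[R]_3 -> probability T R)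
    (X : R -> {mfun T >-> R}) : Prop :=
  forall th, param_o th ->
    is_mfOU (P th) (th 0 0) (th 1 0) (th 2 0) X /\
    forall n, gaussian_vector (P th)
      (covariance_mx (P th) (mfOU_data Delta X n)) (mfOU_data Delta X n).

Definition Xi_m (Delta : nat -> R) (P : 'cV[R]_2 -> probability T R)
    (Y : R -> {mfun T >-> R}) (th0 : 'cV[R]_2) (n : nat) (w : T) : 'cV[R]_2 :=
  cvec2 (Xi_sigma Delta P (mfBm_data Delta Y) th0 n w)
        (Xi_H Delta P (mfBm_data Delta Y) th0 n w).

Definition Xi_o (Delta : nat -> R) (P : 'cV[R]_3 -> probability T R)
    (X : R -> {mfun T >-> R}) (th0 : 'cV[R]_3) (n : nat) (w : T) : 'cV[R]_3 :=
  cvec3 (Xi_sigma Delta P (mfOU_data Delta X) th0 n w)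
        (Xi_H Delta P (mfOU_data Delta X) th0 n w)
        (score P (mfOU_data Delta X) th0 2 n w / Num.sqrt (n%:R * Delta n)).

End Models.

(* Main.v *)
From HB Require Import structures.
Require Import Defs.
From mathcomp Require Import finmap measurable_realfun.
From mathcomp Require Import ring lra.

Set Implicit Arguments.
Unset Strict Implicit.
Unset Printing Implicit Defensive.

(**
  Write Gamma for the critical information matrix restricted to (sigma, H), with
  entries p, q, q, r, and v = r - q^2 / p for the efficient information.  Since
  q / p = sigma / 2 and v = 3 sigma^4 / 64, the statistic T_n is
  (Xi_H - (q / p) Xi_sigma) / sqrt v: the H-score with its regression on the
  sigma-score removed, scaled by its limiting standard deviation.

  The LAN expansion describes everything under the critical law.  To reach the
  local alternatives one uses that the data are Gaussian with the same
  likelihood that appears in LAN, so that the law of the data at the local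
  parameter has density exp(Lambda_n) with respect to its law at the critical
  point, Lambda_n being the log-likelihood difference.  This is Le Cam's third
  lemma: if (T_n, Lambda_n) converges to (T, h.x - h^T Gamma h / 2) with x of law
  N(0, Gamma), the limit of T_n under the alternatives is the law of T reweighted
  by exp(h.x - h^T Gamma h / 2).  The proof given here ([le_cam_third]) only
  bounds lower limits: truncating the exponential gives
    liminf E_n f(T_n) >= E f(T) exp(h.x - h^T Gamma h / 2)
  for continuous bounded f >= 0, and because the right-hand side is the integral
  of f against a probability measure, applying this to M + f and M - f turns the
  lower bound into a limit ([cvg_integral_of_lower_bound]).

  Two points need care.  The change of measure applies to measurable functions
  of the data, while T_n contains derivatives of the log-likelihood, which are
  only known as limits; the log-likelihood being an affine function of finitely
  many quadratic monomials of the data, the set where such a limit exists is the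
  preimage of a linear subspace, which gives the measurability
  ([measurable_derive_gauss_logpdf]).  And Gaussian laws on R^n are given by
  iterated Lebesgue integrals, for which monotone convergence is established
  first ([cvg_integral_Rn]).

  The limit law is explicit ([gauss_integral_mx2]): under N(0, Gamma) the
  variables x_sigma and T are independent, so the density splits into two normal
  densities, and the tilt by h shifts each of them; T is shifted by
  h_H sqrt v.  A third coordinate uncorrelated with the others integrates out
  ([gauss_integral_block]).  With h = 0 this is the null case.  For the tests,
  weak convergence to a continuous law gives convergence of the probabilities of
  half-lines ([cvg_normal_tail]), the normal tail beyond the quantile of 1 - a is
  a ([normal_tail_quantile]), and a positive shift enlarges it strictly
  ([normal_tail_gt]).
*)

(** * Iterated Lebesgue integrals and integration against a density *)

Section Functional.
Context d (T : measurableType d) (R : realType).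
Local Open Scope ereal_scope.

Definition ge0_mfun (f : T -> \bar R) :=
  measurable_fun setT f /\ forall x, 0 <= f x.

Variable mu : {measure set T -> \bar R}.
Variable J : (T -> \bar R) -> \bar R.
Hypothesis J_D : forall f g, ge0_mfun f -> ge0_mfun g ->
  J (fun x => f x + g x) = J f + J g.
Hypothesis J_Z : forall (k : R) f, (0 <= k)%R -> ge0_mfun f ->
  J (fun x => k%:E * f x) = k%:E * J f.
Hypothesis J_cvg : forall (g : (T -> \bar R)^nat) (f : T -> \bar R),
  (forall n, ge0_mfun (g n)) ->
  (forall x, nondecreasing_seq (g ^~ x)) -> (forall x, g ^~ x @ \oo --> f x) ->
  J \o g @ \oo --> J f.
Hypothesis J_indic : forall A, measurable A -> J (EFin \o \1_A) = mu A.

Import HBNNSimple.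

Let J_sum (I : Type) (s : seq I) (f : I -> T -> \bar R) :
  (forall i, ge0_mfun (f i)) ->
  J (fun x => \sum_(i <- s) f i x) = \sum_(i <- s) J (f i).
Proof.
move=> mf; elim: s => [|i s ih].
  under eq_fun do rewrite big_nil; rewrite big_nil.
  have := @J_Z 0%R (cst 0) (lexx _).
  under eq_fun do rewrite mul0e.
  by rewrite mul0e => ->//; split => //; exact: measurable_cst.
rewrite big_cons -ih -J_D//.
  by congr J; apply/funext => x; rewrite big_cons.
split; first by apply: emeasurable_sum => j; case: (mf j).
by move=> x; apply: sume_ge0 => j _; case: (mf j).
Qed.

(** Both sides agree on indicators, hence by additivity and homogeneity on
    simple functions, hence by monotone convergence everywhere. Used to turn
    the description of a law on measurable sets into one on functions. *)
Lemma integral_eq_functional f : ge0_mfun f -> \int[mu]_x f x = J f.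
Proof.
move=> [mf f0].
pose f_ := nnsfun_approx measurableT mf.
have f_f x : EFin \o f_^~ x @ \oo --> f x.
  by apply: cvg_nnsfun_approx => // y _.
have f_nd x : nondecreasing_seq (fun n => (f_ n x)%:E).
  by move=> m n mn; rewrite lee_fin; exact/lefP/nd_nnsfun_approx.
have J1 := @J_cvg (fun n x => (f_ n x)%:E) f.
have mf_ n : ge0_mfun (fun x => (f_ n x)%:E).
  split; first exact/measurable_EFinP/measurable_funP.
  by move=> x; rewrite lee_fin.
have {}J1 := J1 mf_ f_nd f_f.
suff J2 : J \o (fun n x => (f_ n x)%:E) @ \oo --> \int[mu]_x f x.
  exact: (cvg_unique _ J2 J1).
have -> : \int[mu]_x f x = \int[mu]_x limn (EFin \o f_^~ x).
  by apply: eq_integral => x _; apply/esym/cvg_lim.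
rewrite [X in X @ _ --> _](_ : _ = fun n => \int[mu]_x (f_ n x)%:E); last first.
  apply/funext => n /=; rewrite integral_nnsfun// patch_setT sintegralE.
  under eq_fun do rewrite fimfunE -fsumEFin//.
  rewrite fsbig_finite//=.
  have -> : (fun x => \sum_(i \in range (f_ n)) (i * \1_(f_ n @^-1` [set i]) x)%:E) =
     (fun x => \sum_(i <- fset_set (range (f_ n))) (i * \1_(f_ n @^-1` [set i]) x)%:E).
    by apply/funext => x; rewrite fsbig_finite.
  rewrite J_sum.
    apply: eq_bigr => i _.
    have [i0|i0] := leP 0%R i.
      rewrite -J_indic//.
      under eq_fun do rewrite EFinM.
      rewrite J_Z//; split=> /=; first exact/measurable_EFinP.
      by move=> x; rewrite lee_fin.
    rewrite preimage_nnfun0//.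
    rewrite measure0 mule0.
    under eq_fun do rewrite indic0 mulr0.
    by rewrite -[RHS](measure0 mu); have := J_indic measurable0; rewrite indic0.
  move=> i; split; first exact/measurable_EFinP/measurable_funM.
  by move=> x; exact: nnfun_muleindic_ge0.
apply: cvg_monotone_convergence => //.
- by move=> n; case: (mf_ n).
- by move=> n x _; case: (mf_ n).
Qed.

End Functional.

Section IntegralRn.
Context (R : realType).
Local Open Scope ereal_scope.
Local Notation mu := (@lebesgue_measure R).

Lemma integral_Rn_ge0 n (f : n.-tuple R -> \bar R) :
  (forall t, 0 <= f t) -> 0 <= integral_Rn f.
Proof.
elim: n f => [|n ih] f f0 /=; first exact: f0.
by apply: integral_ge0 => x _; exact: ih.
Qed.

Lemma eq_integral_Rn n (f g : n.-tuple R -> \bar R) :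
  f =1 g -> integral_Rn f = integral_Rn g.
Proof. by move=> /funext ->. Qed.

(** The parameter [s] ranges over an arbitrary measurable space so that the
    induction on the dimension can absorb one more coordinate into it; each
    step is the measurability part of Tonelli's theorem. *)
Lemma measurable_integral_Rn n d (S : measurableType d)
    (f : S * n.-tuple R -> \bar R) :
  ge0_mfun f -> measurable_fun setT (fun s => integral_Rn (fun t => f (s, t))).
Proof.
elim: n d S f => [|n ih] d S f [mf f0] /=.
  by apply: measurableT_comp => //; exact: measurable_fun_pair.
have := @measurable_fun_fubini_tonelli_F _ _ S (measurableTypeR R) R mu
  (fun sx => integral_Rn (fun t => f (sx.1, [tuple of sx.2 :: t]))).
apply.
  have := ih _ (S * R)%type
    (fun p : (S * R) * n.-tuple R => f (p.1.1, [tuple of p.1.2 :: p.2])).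
  apply; split => //.
  apply: measurableT_comp => //; apply: measurable_fun_pair => //=.
    exact: measurableT_comp.
  by apply: measurable_cons => //; exact: measurableT_comp.
by move=> [s x]; apply: integral_Rn_ge0 => t /=.
Qed.

Lemma ge0_mfun_tail n (f : n.+1.-tuple R -> \bar R) x :
  ge0_mfun f -> ge0_mfun (fun t : n.-tuple R => f [tuple of x :: t]).
Proof.
move=> [mf f0]; split => //; apply: measurableT_comp => //.
exact: measurable_cons.
Qed.

Lemma ge0_mfun_integral_tail n (f : n.+1.-tuple R -> \bar R) : ge0_mfun f ->
  ge0_mfun (fun x : R => integral_Rn (fun t : n.-tuple R => f [tuple of x :: t])).
Proof.
move=> [mf f0]; split; last by move=> x; exact: integral_Rn_ge0.
have := @measurable_integral_Rn n _ R (fun p => f [tuple of p.1 :: p.2]).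
apply; split => //; apply: measurableT_comp => //.
exact: measurable_cons.
Qed.

Lemma integral_RnD n (f g : n.-tuple R -> \bar R) : ge0_mfun f -> ge0_mfun g ->
  integral_Rn (fun t => f t + g t) = integral_Rn f + integral_Rn g.
Proof.
elim: n f g => [//|n ih] f g mf mg /=.
have [Mf f0] := ge0_mfun_integral_tail mf.
have [Mg g0] := ge0_mfun_integral_tail mg.
rewrite -ge0_integralD//; apply: eq_integral => x _.
by apply: ih; exact: ge0_mfun_tail.
Qed.

Lemma integral_RnZ n (k : R) (f : n.-tuple R -> \bar R) : (0 <= k)%R ->
  ge0_mfun f -> integral_Rn (fun t => k%:E * f t) = k%:E * integral_Rn f.
Proof.
move=> k0; elim: n f => [//|n ih] f mf /=.
have [Mf f0] := ge0_mfun_integral_tail mf.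
rewrite -ge0_integralZl_EFin//; apply: eq_integral => x _.
by apply: ih; exact: ge0_mfun_tail.
Qed.

Lemma le_integral_Rn n (f g : n.-tuple R -> \bar R) : ge0_mfun f -> ge0_mfun g ->
  (forall t, f t <= g t) -> integral_Rn f <= integral_Rn g.
Proof.
elim: n f g => [|n ih] f g mf mg fg /=; first exact: fg.
have [? ?] := ge0_mfun_integral_tail mf.
have [? ?] := ge0_mfun_integral_tail mg.
apply: ge0_le_integral => // x _; apply: ih => //; exact: ge0_mfun_tail.
Qed.

(** Monotone convergence for one variable, applied to the innermost integral
    first. *)
Lemma cvg_integral_Rn n (g : (n.-tuple R -> \bar R)^nat) (f : n.-tuple R -> \bar R) :
  (forall k, ge0_mfun (g k)) -> (forall t, nondecreasing_seq (g ^~ t)) ->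
  (forall t, g ^~ t @ \oo --> f t) ->
  (fun k => integral_Rn (g k)) @ \oo --> integral_Rn f.
Proof.
elim: n g f => [|n ih] g f mg ndg gf /=; first exact: gf.
have ihx x : (fun k => integral_Rn (fun t : n.-tuple R => g k [tuple of x :: t])) @ \oo
   --> integral_Rn (fun t : n.-tuple R => f [tuple of x :: t]).
  apply: ih => [k|t|t]; first exact: ge0_mfun_tail.
  - exact: ndg.
  - exact: gf.
rewrite (_ : \int[_]_x _ = \int[mu]_x
   limn (fun k => integral_Rn (fun t : n.-tuple R => g k [tuple of x :: t]))); last first.
  by apply: eq_integral => x _; apply/esym/cvg_lim.
apply: cvg_monotone_convergence => //.
- by move=> k; case: (ge0_mfun_integral_tail (mg k)).
- by move=> k x _; case: (ge0_mfun_integral_tail (mg k)).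
- move=> x _ k l kl; apply: le_integral_Rn; [exact: ge0_mfun_tail..|].
  by move=> t; exact: ndg.
Qed.

(** Gaussian vectors are specified through the probabilities of measurable
    sets, while a change of measure integrates functions; this is the passage
    from the former to the latter. *)
Lemma integral_density_Rn n d (T : measurableType d) (P : {measure set T -> \bar R})
    (X : T -> n.-tuple R) (p : n.-tuple R -> R) :
  measurable_fun setT X -> measurable_fun setT p -> (forall t, 0 <= p t)%R ->
  (forall A, measurable A ->
     P (X @^-1` A) = integral_Rn (fun t => (\1_A t * p t)%:E)) ->
  forall g : n.-tuple R -> \bar R, ge0_mfun g ->
  \int[P]_w g (X w) = integral_Rn (fun t => g t * (p t)%:E).
Proof.
move=> mX mp p0 PX g mg.
have mw u : ge0_mfun u -> ge0_mfun (fun t => u t * (p t)%:E).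
  move=> [mu' u0]; split.
    by apply: emeasurable_funM => //; exact/measurable_EFinP.
  by move=> t; rewrite mule_ge0// lee_fin.
transitivity (\int[pushforward P X]_y g y).
  rewrite (ge0_integral_pushforward mX _ measurableT mg.1)//.
  by move=> y _; exact: mg.2.
apply: (@integral_eq_functional _ _ _ _ (fun u => integral_Rn (fun t => u t * (p t)%:E))) => //.
- move=> u v mu' mv; rewrite -integral_RnD; [|exact: mw..].
  apply: eq_integral_Rn => t; rewrite (ge0_muleDl _ (mu'.2 t) (mv.2 t))//.
- move=> k u k0 mu'; rewrite -integral_RnZ//; last exact: mw.
  by apply: eq_integral_Rn => t; rewrite muleA.
- move=> h u mh ndh hu; apply: cvg_integral_Rn.
  + by move=> k; exact: mw.
  + by move=> t k l kl; rewrite lee_wpmul2r ?lee_fin//; exact: ndh.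
  + by move=> t; apply: cvgeZr => //; exact: hu.
- by move=> A mA; exact/esym/PX.
Qed.

Lemma integral_normal_prob (m s : R) (f : R -> \bar R) : ge0_mfun f ->
  \int[normal_prob m s]_x f x = \int[mu]_x (f x * (normal_pdf m s x)%:E).
Proof.
move=> mf.
have mw u : ge0_mfun u -> ge0_mfun (fun t => u t * (normal_pdf m s t)%:E).
  move=> [mu' u0]; split.
    apply: emeasurable_funM => //; apply/measurable_EFinP.
    exact: measurable_normal_pdf.
  by move=> t; rewrite mule_ge0// lee_fin normal_pdf_ge0.
apply: (@integral_eq_functional _ _ _ _
  (fun u => \int[mu]_t (u t * (normal_pdf m s t)%:E))) => //.
- move=> u v mu' mv.
  have [? ?] := mw _ mu'; have [? ?] := mw _ mv.
  rewrite -ge0_integralD//; apply: eq_integral => t _.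
  by rewrite (ge0_muleDl _ (mu'.2 t) (mv.2 t)).
- move=> k u k0 mu'; have [? ?] := mw _ mu'.
  rewrite -ge0_integralZl_EFin//.
  by apply: eq_integral => t _; rewrite muleA.
- move=> h u mh ndh hu /=.
  rewrite (_ : \int[mu]_t (u t * _) = \int[mu]_t limn (fun k => h k t * (normal_pdf m s t)%:E)).
    apply: cvg_monotone_convergence => //.
    + by move=> n; case: (mw _ (mh n)).
    + by move=> n x _; case: (mw _ (mh n)).
    + move=> x _ k l kl; rewrite lee_wpmul2r ?lee_fin ?normal_pdf_ge0//.
      exact: ndh.
  apply: eq_integral => t _; apply/esym/cvg_lim => //.
  by apply: cvgeZr => //; exact: hu.
- move=> A mA; transitivity (\int[mu]_(x in A) (normal_pdf m s x)%:E); last by [].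
  rewrite [in RHS]integral_mkcond.
  apply: eq_integral => x _; rewrite /= patchE indicE.
  by case: ifP => _; rewrite ?mul1e ?mul0e.
Qed.

End IntegralRn.

(** * Weak convergence of real statistics *)

Section WeakConvergence.
Context (R : realType).
Local Open Scope ereal_scope.

Lemma integrable_bounded d (T : measurableType d) (P : probability T R) (f : T -> R) M :
  measurable_fun setT f -> (forall x, `|f x| <= M)%R ->
  P.-integrable setT (EFin \o f).
Proof.
move=> mf fM; apply: measurable_bounded_integrable => //.
  by rewrite (le_lt_trans (probability_le1 _ _))// ltry.
by exists M; split; [exact: num_real|move=> N MN x _ /=; exact: le_trans (fM x) (ltW MN)].
Qed.

Lemma integral_affine d (T : measurableType d) (P : probability T R) (f : T -> R) M a b :
  measurable_fun setT f -> (forall x, `|f x| <= M)%R ->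
  \int[P]_x (a + b * f x)%:E = (a + b * fine (\int[P]_x (f x)%:E))%:E.
Proof.
move=> mf fM; have If := integrable_bounded P mf fM.
under eq_integral do rewrite EFinD EFinM.
rewrite integralD//=.
- rewrite integral_cst//= probability_setT mule1 integralZl//.
  by rewrite EFinD EFinM fineK//; exact: integrable_fin_num.
- exact: (finite_measure_integrable_cst P a).
- exact: (integrableZl _ _ If).
Qed.

(** Lower bounds suffice: for a function bounded by M, both M + f and M - f
    are nonnegative, and the total masses on the two sides are equal, so that
    the lower bounds for these two functions bound the integral of f from
    below and from above. *)
Lemma cvg_integral_of_lower_bound d (T : measurableType d) (Q : nat -> probability T R)
    (Y : nat -> T -> R) (nu : probability (measurableTypeR R) R) :
  (forall n, measurable_fun setT (Y n)) ->
  (forall (f : R -> R) K, continuous f -> (forall x, 0 <= f x <= K)%R ->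
     forall e : R, (0 < e)%R -> \forall n \near \oo,
       \int[nu]_x (f x)%:E <= \int[Q n]_w (f (Y n w))%:E + e%:E) ->
  forall f : R -> R, bounded_continuous f ->
    (fun n => \int[Q n]_w (f (Y n w))%:E) @ \oo --> \int[nu]_x (f x)%:E.
Proof.
move=> mY lower f [cf [M fM]].
have mf : measurable_fun setT f by exact: continuous_measurable_fun.
have mfY n : measurable_fun setT (fun w => f (Y n w)) by exact: measurableT_comp.
(* b = 1 and b = -1 are the upper and the lower half of the limit. *)
have ls b : (b = 1 \/ b = -1)%R -> forall e : R, (0 < e)%R -> \forall n \near \oo,
    (b * fine (\int[nu]_x (f x)%:E) <= b * fine (\int[Q n]_w (f (Y n w))%:E) + e)%R.
  move=> b1 e e0; have := lower (fun x => M + b * f x)%R (M + M)%R.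
  have -> : \int[nu]_x (M + b * f x)%:E = (M + b * fine (\int[nu]_x (f x)%:E))%:E.
    exact: (@integral_affine _ (measurableTypeR R) nu f M M b mf fM).
  move=> /(_ _ _ e e0) h; apply: filterS (h _ _).
  - move=> n; rewrite (integral_affine _ _ _ (mfY n) (fun w => fM (Y n w))).
    by rewrite -EFinD lee_fin -addrA lerD2l.
  - move=> x; apply: cvgD; first exact: cvg_cst.
    by apply: cvgM; [exact: cvg_cst|exact: cf].
  - move=> x; have := fM x; rewrite ler_norml => /andP[? ?].
    by case: b1 => ->; apply/andP; split; lra.
have finnu : \int[nu]_x (f x)%:E \is a fin_num.
  exact: (integrable_fin_num _ (integrable_bounded nu mf fM)).
have finQ n : \int[Q n]_w (f (Y n w))%:E \is a fin_num.
  exact: (integrable_fin_num _ (integrable_bounded (Q n) (mfY n) (fun w => fM (Y n w)))).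
rewrite -(fineK finnu); apply/fine_cvgP; split; first by near=> n.
apply/cvgrPdist_le => e e0; near=> n.
rewrite ler_norml; apply/andP; split.
  have : (-1 * fine (\int[nu]_x (f x)%:E) <= -1 * fine (\int[Q n]_w (f (Y n w))%:E) + e)%R.
    by near: n; apply: ls => //; right.
  by rewrite /=; lra.
have : (1 * fine (\int[nu]_x (f x)%:E) <= 1 * fine (\int[Q n]_w (f (Y n w))%:E) + e)%R.
  by near: n; apply: ls => //; left.
by rewrite /=; lra.
Unshelve. all: end_near. Qed.

Lemma cvg_near_le (u : (\bar R)^nat) (l : \bar R) (e : R) : l \is a fin_num ->
  u @ \oo --> l -> (0 < e)%R -> \forall n \near \oo, l <= u n + e%:E.
Proof.
move=> finl; rewrite -(fineK finl) => /fine_cvgP[finu /cvgrPdist_le ul] e0.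
near=> n.
have finn : u n \is a fin_num by near: n.
rewrite -(fineK finn) -EFinD lee_fin -lerBlDl.
by apply: le_trans (ler_norm _) _; near: n; exact: ul.
Unshelve. all: end_near. Qed.

Lemma cvg_near_ge (u : (\bar R)^nat) (l : \bar R) (e : R) : l \is a fin_num ->
  u @ \oo --> l -> (0 < e)%R -> \forall n \near \oo, u n <= l + e%:E.
Proof.
move=> finl; rewrite -(fineK finl) => /fine_cvgP[finu /cvgrPdist_le ul] e0.
near=> n.
have finn : u n \is a fin_num by near: n.
rewrite -(fineK finn) -EFinD lee_fin -lerBlDl.
apply: le_trans (ler_norm _) _; rewrite distrC; near: n; exact: ul.
Unshelve. all: end_near. Qed.

Local Notation positives := [set y : R | (0 < y)%R].

(** Continuous functions increasing to the indicator of the positive reals. *)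
Definition ramp (k : nat) (x : R) : R := (Num.min 1 (k%:R * Num.max 0 x))%R.

Lemma continuous_ramp k : continuous (ramp k).
Proof.
apply: (@min_fun_continuous _ _ R (cst 1%R) (fun y : R => k%:R * Num.max 0 y)%R).
  exact: cst_continuous.
move=> x; apply: cvgM; first exact: cvg_cst.
apply: (@max_fun_continuous _ _ R (cst 0%R) id) => y; [exact: cvg_cst|exact: cvg_id].
Qed.

Lemma ramp_ge0 k x : (0 <= ramp k x)%R.
Proof. by rewrite /ramp le_min ler01 mulr_ge0// le_max lexx. Qed.

Lemma ramp_le_indic k x : (ramp k x <= \1_positives x)%R.
Proof.
rewrite indicE /ramp; have [x0|x0] := ltP 0%R x.
  by rewrite mem_set// ge_min lexx.
by rewrite memNset/= ?mulr0 ?minxx ?ge_min ?lexx ?orbT//; apply/negP; rewrite -leNgt.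
Qed.

Lemma cvg_ramp x : ramp ^~ x @ \oo --> (\1_positives x : R).
Proof.
rewrite indicE /ramp; have [x0|x0] := ltP 0%R x; last first.
  rewrite memNset; last by apply/negP; rewrite -leNgt.
  by under eq_fun do rewrite mulr0 min_r//; exact: cvg_cst.
rewrite mem_set//; apply: cvg_near_cst; near=> k.
apply/min_idPl; rewrite -ler_pdivrMr// mul1r.
by near: k; exact: nbhs_infty_ger.
Unshelve. all: end_near. Qed.

Lemma nondecreasing_ramp x : nondecreasing_seq (ramp ^~ x).
Proof.
move=> k l kl; rewrite /ramp le_min ge_min lexx/= ge_min; apply/orP; right.
by rewrite ler_wpM2r ?ler_nat// le_max lexx.
Qed.

Lemma measurable_pos_preimage (u : R -> R) : continuous u ->
  measurable [set x | 0 < u x]%R.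
Proof.
move=> /continuous_measurable_fun mu'.
have -> : [set x | 0 < u x]%R = setT `&` u @^-1` `]0%R, +oo[%classic.
  by rewrite setTI; apply/seteqP; split => x/=; rewrite in_itv/= andbT.
exact: mu'.
Qed.

Lemma cvg_integral_ramp (nu : probability (measurableTypeR R) R) (u : R -> R) :
  continuous u ->
  (fun k => \int[nu]_x (ramp k (u x))%:E) @ \oo --> nu [set x | 0 < u x]%R.
Proof.
move=> cu; have mu' := continuous_measurable_fun cu.
have mA := measurable_pos_preimage cu.
have mr k : measurable_fun setT (fun x => ramp k (u x)).
  exact: (measurableT_comp (continuous_measurable_fun (@continuous_ramp k)) mu').
have -> : nu [set x | 0 < u x]%R = \int[nu]_x (\1_positives (u x))%:E.
  rewrite -(setIT [set x | 0 < u x]%R) -integral_indic//.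
rewrite (_ : \int[nu]_x _ = \int[nu]_x limn (fun k => (ramp k (u x))%:E)); last first.
  apply: eq_integral => x _; apply/esym/cvg_lim => //.
  by apply/fine_cvgP; split; [exact: nearW|exact: cvg_ramp].
apply: cvg_monotone_convergence => //.
- by move=> k; apply/measurable_EFinP; exact: mr.
- by move=> k x _; rewrite lee_fin ramp_ge0.
- by move=> x _ k l kl; rewrite lee_fin nondecreasing_ramp.
Qed.

(** Approximation of the open set from inside by the continuous functions
    [ramp k \o u]. *)
Lemma portmanteau_open d (T : measurableType d) (Q : nat -> probability T R)
    (Y : nat -> T -> R) (nu : probability (measurableTypeR R) R) (u : R -> R) :
  (forall n, measurable_fun setT (Y n)) ->
  (forall f : R -> R, bounded_continuous f ->
    (fun n => \int[Q n]_w (f (Y n w))%:E) @ \oo --> \int[nu]_x (f x)%:E) ->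
  continuous u ->
  forall e : R, (0 < e)%R -> \forall n \near \oo,
    nu [set x | 0 < u x]%R <= Q n [set w | 0 < u (Y n w)]%R + e%:E.
Proof.
move=> mY cvgQ cu e e0.
have mu' : measurable_fun setT u by exact: continuous_measurable_fun.
have mA := measurable_pos_preimage cu.
have mr k : measurable_fun setT (fun x => ramp k (u x)).
  exact: (measurableT_comp (continuous_measurable_fun (@continuous_ramp k)) mu').
have lim1 := @cvg_integral_ramp nu u cu.
have finnu : nu [set x | 0 < u x]%R \is a fin_num by exact: fin_num_measure.
have [k hk] : exists k, nu [set x | 0 < u x]%R <= \int[nu]_x (ramp k (u x))%:E + (e / 2)%:E.
  have [k _ hk] := cvg_near_le finnu lim1 (divr_gt0 e0 (ltr0Sn _ 1)).
  by exists k; exact: hk k (leqnn k).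
have r1 k' x : (`|ramp k' x| <= 1)%R.
  by rewrite ger0_norm ?ramp_ge0// (le_trans (ramp_le_indic _ _))// indicE; case: (_ \in _).
have cr : bounded_continuous (fun x => ramp k (u x)).
  split; last by exists 1%R => x; exact: r1.
  by move=> x; apply: continuous_comp; [exact: cu|exact: continuous_ramp].
have mrY n : measurable_fun setT (fun w => ramp k (u (Y n w))).
  exact: (measurableT_comp (mr k)).
have finr : \int[nu]_x (ramp k (u x))%:E \is a fin_num.
  exact: (integrable_fin_num _ (integrable_bounded nu (mr k) (fun x => r1 k (u x)))).
apply: filterS (cvg_near_le finr (cvgQ _ cr) (divr_gt0 e0 (ltr0Sn _ 1))) => n hn.
apply: (le_trans hk).
apply: (@le_trans _ _ (\int[Q n]_w (ramp k (u (Y n w)))%:E + (e / 2)%:E + (e / 2)%:E)).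
  by rewrite leeD2r.
rewrite -addeA -EFinD -splitr leeD2r//.
have -> : Q n [set w | 0 < u (Y n w)]%R = \int[Q n]_w (\1_positives (u (Y n w)))%:E.
  rewrite -(setIT [set w | 0 < u (Y n w)]%R) -integral_indic//.
  rewrite -[X in measurable X]setTI; exact: (mY n measurableT _ mA).
apply: ge0_le_integral => //.
- by move=> w _; rewrite lee_fin ramp_ge0.
- exact/measurable_EFinP.
- apply/measurable_EFinP.
  have := (measurableT_comp (measurableT_comp (@measurable_indic _ _ R _ positives _) mu') (mY n)).
  apply; rewrite -[X in measurable X](_ : `]0%R, +oo[%classic = _)//.
  by apply/seteqP; split => x/=; rewrite in_itv/= andbT.
- by move=> w _; rewrite lee_fin ramp_le_indic.
Unshelve. all: end_near. Qed.

End WeakConvergence.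

(** * Measurability of the score as a function of the data *)

Section SubspaceKernel.
Variables (R : fieldType) (N : nat) (V : set 'rV[R]_N).
Hypothesis V_lin : forall (a : R) (c d : 'rV[R]_N), V c -> V d -> V (a *: c + d).
Hypothesis V0 : V 0.

Let V_mul m (M : 'M[R]_(m, N)) (D : 'rV[R]_m) : (forall i, V (row i M)) -> V (D *m M).
Proof.
move=> VM; rewrite mulmx_sum_row.
by elim/big_ind: _ => // [x y Vx Vy|i _];
  [rewrite -[x]scale1r; exact: V_lin|rewrite -[_ *: _]addr0; exact: V_lin].
Qed.

(** A matrix of maximal rank among those whose rows lie in [V] has row space
    [V]: a vector of [V] outside of the row space could be appended as one
    more independent row. The cokernel of such a matrix is [K]. *)
Lemma subspace_kernel : exists k (K : 'M[R]_(N, k)), forall c, V c <-> c *m K = 0.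
Proof.
pose P r := `[< exists m (M : 'M[R]_(m, N)), (forall i, V (row i M)) /\ \rank M = r >].
have exP : exists r, P r.
  exists 0; apply/asboolP; exists 1, 0; split; last exact: mxrank0.
  by move=> i; rewrite row0.
have ubP r : P r -> (r <= N)%N.
  by move=> /asboolP[m [M [_ <-]]]; exact: rank_leq_col.
have [r /asboolP[m [M [VM rM]]] rmax] := ex_maxnP exP ubP.
exists N, (cokermx M) => c; split => [Vc|cM].
  apply/eqP; rewrite -submxE.
  have : (\rank (col_mx M c) <= \rank M)%N.
    rewrite rM; apply: rmax; apply/asboolP; exists (m + 1)%N, (col_mx M c).
    split => // i; case: (splitP i) => j ij.
      have -> : i = lshift 1 j by exact/val_inj.
      by rewrite rowKu.
    have -> : i = rshift m j by exact/val_inj.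
    by rewrite rowKd row_id.
  have MMc : (M <= col_mx M c)%MS by rewrite -addsmxE addsmxSl.
  move=> rle; have : (col_mx M c <= M)%MS by rewrite -(geq_leqif (mxrank_leqif_sup MMc)).
  by rewrite -addsmxE addsmx_sub => /andP[].
have /submxP[D ->] : (c <= M)%MS by rewrite submxE cM.
exact: V_mul.
Qed.

End SubspaceKernel.

Section LimitMeasurable.
Context d (T : measurableType d) (R : realType).

Lemma measurable_mulmx_entry N k (u : T -> 'rV[R]_N) (K : 'M[R]_(N, k)) j :
  (forall i, measurable_fun setT (fun x => u x 0 i)) ->
  measurable_fun setT (fun x => (u x *m K) 0 j).
Proof.
move=> mu; under eq_fun do rewrite mxE.
by apply: measurable_sum => i; exact: measurable_funM.
Qed.

(** The set of the coefficient vectors for which the limit exists is a linear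
    subspace, so membership of [u x] is a system of linear equations, and on
    it the limit is computed along the fixed sequence [t]. *)
Lemma measurable_lim_dotmul N (u : T -> 'rV[R]_N) (b : R -> 'rV[R]_N)
    (F : set_system R) (t : R^nat) :
  ProperFilter F -> t @ \oo --> F ->
  (forall i, measurable_fun setT (fun x => u x 0 i)) ->
  measurable_fun setT (fun x => lim ((fun s => (u x *m (b s)^T) 0 0) @ F)).
Proof.
move=> FF tF mu.
pose q (c : 'rV[R]_N) s : R := (c *m (b s)^T) 0 0.
pose V : set 'rV[R]_N := [set c | cvg (q c @ F)].
have [||k [K VK]] := @subspace_kernel R N V.
- move=> a c e; rewrite /V/= => Vc Ve.
  rewrite [q _](_ : _ = (fun s => a * q c s + q e s)); last first.
    by apply/funext => s; rewrite /q mulmxDl -scalemxAl !mxE.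
  by apply: is_cvgD => //; apply: is_cvgM => //; exact: is_cvg_cst.
- rewrite /V/= [q _](_ : _ = cst 0); first exact: is_cvg_cst.
  by apply/funext => s; rewrite /q mul0mx mxE.
(* A sum of squares, to test the system of equations by a single equality. *)
pose inV x := \sum_(j < k) ((u x *m K) 0 j) ^+ 2 == 0.
have inVP x : reflect (V (u x)) (inV x).
  rewrite /inV psumr_eq0; last by move=> j _; exact: sqr_ge0.
  apply: (iffP idP) => [/allP h|/VK uK].
    apply/VK/matrixP => i j; rewrite ord1 [RHS]mxE; apply/eqP.
    by have := h j (mem_index_enum j); rewrite sqrf_eq0.
  by apply/allP => j _; rewrite uK mxE expr0n /= eqxx.
apply: (@measurable_fun_cvg _ _ _ _
  (fun n x => if inV x then q (u x) (t n) else point)).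
  move=> n; apply: measurable_fun_ifT => //.
  - apply: measurable_fun_eqr => //; apply: measurable_sum => j.
    by apply: measurable_funX; exact: measurable_mulmx_entry.
  - exact: measurable_mulmx_entry.
move=> x _; case: inVP => [Vx|nVx].
  exact: (cvg_comp _ _ tF Vx).
rewrite [lim _](_ : _ = point); first exact: cvg_cst.
exact: dvgP.
Qed.

End LimitMeasurable.

Section GaussScore.
Context (R : realType).

(** The log-density is the scalar product of a vector depending on the
    covariance matrix only with the vector of the constant 1 and the monomials
    x_i x_j; this puts it in the scope of [measurable_lim_dotmul]. *)
Definition logpdf_coef n (S : 'M[R]_n) : 'rV[R]_(1 + n * n) :=
  row_mx (- (n%:R / 2) * ln (2 * pi) - ln (\det S) / 2)%:M
         (mxvec (- 2^-1 *: invmx S)).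

Definition quad_features n (x : 'cV[R]_n) : 'rV[R]_(1 + n * n) :=
  row_mx 1%:M (mxvec (x *m x^T)).

Lemma gauss_logpdf_dot n (S : 'M[R]_n) x :
  gauss_logpdf S x = (quad_features x *m (logpdf_coef S)^T) 0 0.
Proof.
rewrite /quad_features /logpdf_coef tr_row_mx mul_row_col mul1mx.
have := mxvec_dotmul (- 2^-1 *: invmx S) x^T x^T; rewrite !trmxK => ->.
rewrite -scalemxAr -scalemxAl /gauss_logpdf !mxE eqxx mulr1n.
by congr (_ + _); rewrite mulNr mulrC.
Qed.

Lemma measurable_col_of_tuple n (i : 'I_n) :
  measurable_fun setT (fun x : n.-tuple R => col_of_tuple x i 0).
Proof. by under eq_fun do rewrite mxE; exact: measurable_tnth. Qed.

Lemma measurable_quad_features n j :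
  measurable_fun setT (fun x : n.-tuple R => quad_features (col_of_tuple x) 0 j).
Proof.
rewrite /quad_features; case: (split_ordP j) => k ->.
  by under eq_fun do rewrite row_mxEl; exact: measurable_cst.
case: (mxvec_indexP k) => a b.
under eq_fun do rewrite row_mxEr mxvecE mxE big_ord1 [_^T _ _]mxE.
by apply: measurable_funM; exact: measurable_col_of_tuple.
Qed.

Lemma measurable_gauss_logpdf n (S : 'M[R]_n) :
  measurable_fun setT (fun x : n.-tuple R => gauss_logpdf S (col_of_tuple x)).
Proof.
under eq_fun do rewrite gauss_logpdf_dot.
by apply: measurable_mulmx_entry => j; exact: measurable_quad_features.
Qed.

Lemma measurable_derive_gauss_logpdf n p (S : 'cV[R]_p -> 'M[R]_n) (a v : 'cV[R]_p) :
  measurable_fun setT (fun x : n.-tuple R =>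
    'D_v (fun theta => gauss_logpdf (S theta) (col_of_tuple x)) a : R).
Proof.
pose b (s : R) := s^-1 *: (logpdf_coef (S (s *: v + a)) - logpdf_coef (S a)).
rewrite [X in measurable_fun _ X](_ : _ = fun x =>
    lim ((fun s => (quad_features (col_of_tuple x) *m (b s)^T) 0 0) @ 0^')).
  apply: (@measurable_lim_dotmul _ _ _ _ _ _ _ (@harmonic R)).
  - move=> A; rewrite /dnbhs /within /= => /(cvg_harmonic (R := R)) hA.
    change (\forall k \near \oo, A (harmonic k : R)); move: hA.
    by apply: (@filterS _ (\oo : set_system nat)) => k /=; apply; exact: lt0r_neq0 (harmonic_gt0 k).
  - by move=> i; exact: measurable_quad_features.
apply/funext => x; rewrite /derive; apply: (f_equal (fun f : R -> R => lim (f @ 0^'))); apply/funext => s /=.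
rewrite !gauss_logpdf_dot /b.
have -> (r : R) (y z w : 'rV[R]_(1 + n * n)) : (w *m (r *: (y - z))^T) 0 0 =
    r * ((w *m y^T) 0 0 - (w *m z^T) 0 0).
  rewrite linearZ/= -scalemxAr linearB/= mulmxBr [LHS]mxE.
  by congr (_ * _); rewrite [LHS]mxE; congr (_ + _); exact: mxE.
by [].
Qed.

End GaussScore.

(** * Le Cam's third lemma *)

Section ThirdLemma.
Context (R : realType).

(** The exponential truncated at [b] has slope at most [expR b]; this lets an
    o_P(1) term be dropped inside a truncated likelihood ratio. *)
Lemma expR_min_lipschitz (b x y : R) :
  expR (Num.min x b) <= expR (Num.min y b) + expR b * `|y - x|.
Proof.
set p := Num.min x b; set q := Num.min y b.
have pq : p - q <= `|y - x|.
  rewrite /p /q; have := ler_norm (x - y); rewrite distrC => h.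
  have h0 := normr_ge0 (y - x).
  by case: (leP x b); case: (leP y b) => ? ?; lra.
have pb : expR p <= expR b by rewrite ler_expR ge_min lexx orbT.
have : expR p * (p - q) <= expR b * `|y - x|.
  apply: (@le_trans _ _ (expR p * `|y - x|)); first by rewrite ler_wpM2l ?expR_ge0.
  by rewrite ler_wpM2r.
have : expR p * (1 + (q - p)) <= expR q.
  by rewrite -[in leRHS](subrK p q) expRD mulrC ler_wpM2r ?expR_ge0 ?expR_ge1Dx.
rewrite mulrDr mulr1 !mulrBr; lra.
Qed.

Lemma continuous_dotmul k (c : 'cV[R]_k) :
  continuous (fun x : 'cV[R]_k => (c^T *m x) 0 0 : R).
Proof.
have -> : (fun x : 'cV[R]_k => (c^T *m x) 0 0) = (fun x => \sum_(i < k) c i 0 * x i 0).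
  by apply/funext => x; rewrite mxE; apply: eq_bigr => i _; rewrite mxE.
apply: (continuous_big (op := +%R)) => [|i _ x]; first exact: add_continuous.
have h1 : (fun=> c i 0) @ nbhs x --> c i 0 by exact: cvg_cst.
apply: (cvgM h1).
exact: coord_continuous.
Qed.

Lemma measurable_dotmul d (T : measurableType d) k (c : 'cV[R]_k) (X : T -> 'cV[R]_k) :
  (forall i, measurable_fun setT (fun w => X w i 0)) ->
  measurable_fun setT (fun w => (c^T *m X w) 0 0).
Proof.
move=> mX; under eq_fun do rewrite mxE.
by apply: measurable_sum => i; apply: measurable_funM => //; exact: mX.
Qed.

Lemma continuous_min_cst (b : R) : continuous (fun y : R => Num.min y b).
Proof.
by apply: (@min_fun_continuous _ _ R id (cst b)) => y; [exact: cvg_id|exact: cvg_cst].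
Qed.

Local Open Scope ereal_scope.

Context d (T : measurableType d).
Variables (P0 : probability T R) (Q : nat -> probability T R).
Variables (k : nat) (Xi : nat -> T -> 'cV[R]_k) (S : 'M[R]_k).
Variables (L : nat -> T -> R) (c h : 'cV[R]_k) (kappa : R).
Variable nu : probability (measurableTypeR R) R.
Let Y n w : R := ((c^T *m Xi n w) 0 0)%R.

(** For nonnegative f, the integral of f(Y_n) exp(L_n) is at least that of
    f(Y_n) exp(min L_n b). In the latter, L_n may be replaced by its linear
    approximation up to a vanishing error, which makes the integrand a bounded
    continuous function of Xi_n, so that its integral converges. Letting b
    grow recovers the tilted Gaussian integral by monotone convergence, and
    [cvg_integral_of_lower_bound] concludes. That no mass of the likelihood
    ratios escapes is encoded in the total mass 1 of the limit [nu]. *)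
Lemma le_cam_third :
  cvg_gaussian (fun=> P0) Xi S ->
  (forall n, measurable_fun setT (L n)) ->
  small_o_proba P0 (fun n w => L n w - ((h^T *m Xi n w) 0 0 - kappa))%R ->
  (\forall n \near \oo, forall f : R -> R, continuous f -> (forall x, 0 <= f x)%R ->
    \int[Q n]_w (f (Y n w))%:E = \int[P0]_w (f (Y n w) * expR (L n w))%:E) ->
  (forall f : R -> R, continuous f -> (forall x, 0 <= f x)%R ->
    gauss_integral_Rn S (fun x => f ((c^T *m x) 0 0)%R * expR ((h^T *m x) 0 0 - kappa))%R
    = \int[nu]_x (f x)%:E) ->
  forall f : R -> R, bounded_continuous f ->
    (fun n => \int[Q n]_w (f (Y n w))%:E) @ \oo --> \int[nu]_x (f x)%:E.
Proof.
move=> [mXi cvgXi] mL oZ chg lim.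
have mY n : measurable_fun setT (Y n) by exact: measurable_dotmul.
apply: cvg_integral_of_lower_bound => // f K cf fK e e0.
have f0 x : (0 <= f x)%R by case/andP: (fK x).
have K0 : (0 <= K)%R by case/andP: (fK 0%R) => /le_trans; apply.
have mf := continuous_measurable_fun cf.
pose v (x : 'cV[R]_k) : R := ((h^T *m x) 0 0 - kappa)%R.
pose g (b : R) (x : 'cV[R]_k) : R := (f ((c^T *m x) 0 0) * expR (Num.min (v x) b))%R.
pose ge (x : 'cV[R]_k) : R := (f ((c^T *m x) 0 0) * expR (v x))%R.
have g0 b x : (0 <= g b x)%R by rewrite mulr_ge0 ?expR_ge0.
have ge0 x : (0 <= ge x)%R by rewrite mulr_ge0 ?expR_ge0.
have gge b x : (g b x <= ge x)%R.
  by rewrite ler_wpM2l// ler_expR ge_min lexx.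
have mcol i : measurable_fun setT (fun t : k.-tuple R => col_of_tuple t i (0 : 'I_1)%R).
  exact: measurable_col_of_tuple.
have mv : measurable_fun setT (fun t : k.-tuple R => v (col_of_tuple t)).
  by apply: measurable_funB => //; exact: measurable_dotmul.
have mfc : measurable_fun setT (fun t : k.-tuple R => f ((c^T *m col_of_tuple t) 0 0)%R).
  by apply: measurableT_comp => //; exact: measurable_dotmul.
have mpdf (u : k.-tuple R -> R) :
    measurable_fun setT u -> (forall t, 0 <= u t)%R ->
    ge0_mfun (fun t : k.-tuple R => (u t * expR (gauss_logpdf S (col_of_tuple t)))%:E).
  move=> mu' u0; split.
    apply/measurable_EFinP; apply: measurable_funM => //.
    by apply: measurableT_comp => //; exact: measurable_gauss_logpdf.
  by move=> t; rewrite lee_fin mulr_ge0 ?expR_ge0.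
have mexpmin b : measurable_fun setT (fun t : k.-tuple R => expR (Num.min (v (col_of_tuple t)) b)).
  apply: measurableT_comp => //.
  exact: (measurableT_comp (continuous_measurable_fun (@continuous_min_cst b)) mv).
have mg b := mpdf _ (measurable_funM mfc (mexpmin b)) (fun t => g0 b _).
have mge := mpdf _ (measurable_funM mfc (measurableT_comp (@measurable_expR R) mv)) (fun t => ge0 _).
have finnu : \int[nu]_x (f x)%:E \is a fin_num.
  apply: (integrable_fin_num _ (integrable_bounded nu mf (M := K) _)) => // x.
  by rewrite ger0_norm//; case/andP: (fK x).
have Gge : gauss_integral_Rn S ge = \int[nu]_x (f x)%:E by exact: lim.
have finG b : gauss_integral_Rn S (g b) \is a fin_num.
  rewrite ge0_fin_numE; last by apply: integral_Rn_ge0 => t; exact: ((mg b).2 t).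
  apply: (@le_lt_trans _ _ (gauss_integral_Rn S ge)).
    apply: (le_integral_Rn (mg b) mge) => t.
    by rewrite lee_fin ler_wpM2r ?expR_ge0 ?gge.
  by rewrite Gge ltey_eq finnu.
have limG : (fun b : nat => gauss_integral_Rn S (g b%:R)) @ \oo --> \int[nu]_x (f x)%:E.
  rewrite -Gge; apply: cvg_integral_Rn.
  - by move=> b; exact: mg.
  - move=> t b b' bb'; rewrite lee_fin ler_wpM2r ?expR_ge0// ler_wpM2l// ler_expR.
    by rewrite le_min ge_min lexx/= ge_min ler_nat bb' orbT.
  - move=> t; apply: cvg_near_cst; near=> b.
    rewrite /g /ge min_l//; near: b; exact: nbhs_infty_ger.
have e4 : (0 < e / 4)%R by rewrite divr_gt0.
have [b0 _ /(_ b0 (leqnn _)) hb] := cvg_near_le finnu limG e4.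
move: hb; set b : R := b0%:R => hb.
have gbc : bounded_continuous (g b).
  split.
    have cv : continuous v.
      have c0 : continuous (fun y : R => y - kappa)%R.
        by move=> y; apply: cvgB; [exact: cvg_id|exact: cvg_cst].
      move=> x; exact: (continuous_comp (@continuous_dotmul k h x) (c0 _)).
    have c1 : continuous (f \o (fun x : 'cV[R]_k => (c^T *m x) 0 0)%R).
      by move=> x; apply: continuous_comp; [exact: continuous_dotmul|exact: cf].
    have c2 : continuous ((fun y : R => Num.min y b) \o v).
      by move=> x; apply: continuous_comp; [exact: cv|exact: continuous_min_cst].
    have c3 : continuous (expR \o ((fun y : R => Num.min y b) \o v)).
      by move=> x; apply: continuous_comp; [exact: c2|exact: continuous_expR].
    by move=> x; exact: (cvgM (c1 x) (c3 x)).
  exists (K * expR b)%R => x; rewrite ger0_norm// ler_pM ?expR_ge0//.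
    by case/andP: (fK ((c^T *m x) 0 0)%R).
  by rewrite ler_expR ge_min lexx orbT.
have Kb0 : (0 < (K + 1) * expR b)%R by rewrite mulr_gt0 ?expR_gt0// ltr_wpDl.
(* dl bounds both the remainder off the exceptional set B and the probability
   of B; K + 1 instead of K avoids a division by zero. *)
pose dl := (e / 4 / ((K + 1) * expR b))%R.
have dl0 : (0 < dl)%R by rewrite divr_gt0.
have Kdl : (K * expR b * dl <= e / 4)%R.
  rewrite /dl mulrCA ger_pMr// ler_pdivrMr// mul1r ler_wpM2r ?expR_ge0//; lra.
have oZdl := cvg_near_ge (isT : 0 \is a fin_num) (oZ _ dl0) dl0.
have cvgg := cvg_near_le (finG b) (cvgXi _ gbc) e4.
near=> n.
have oZn : P0 [set w | dl < `|L n w - ((h^T *m Xi n w) 0 0 - kappa)|]%R <= 0 + dl%:E.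
  by near: n.
have cvgn : gauss_integral_Rn S (g b) <= \int[P0]_w (g b (Xi n w))%:E + (e / 4)%:E.
  by near: n.
have -> : \int[Q n]_w (f (Y n w))%:E = \int[P0]_w (f (Y n w) * expR (L n w))%:E.
  by apply: (near chg n).
pose Z w := (L n w - v (Xi n w))%R.
pose B := [set w | dl < `|Z w|]%R.
have mvX : measurable_fun setT (fun w => v (Xi n w)).
  by apply: measurable_funB => //; exact: measurable_dotmul.
have mB : measurable B.
  rewrite -[X in measurable X]setTI.
  have := measurable_fun_ltr (measurable_cst dl) (measurableT_comp (@normr_measurable R setT) (measurable_funB (mL n) mvX)).
  by move=> /(_ measurableT [set true] I).
have PB : P0 B <= dl%:E.
  by move: oZn; rewrite add0e.
have mfY : measurable_fun setT (fun w => f (Y n w)) by exact: measurableT_comp.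
apply: (le_trans hb).
apply: (@le_trans _ _ (\int[P0]_w (g b (Xi n w))%:E + (e / 4)%:E + (e / 4)%:E)).
  by rewrite leeD2r.
apply: (@le_trans _ _ (\int[P0]_w (f (Y n w) * expR (L n w) + (e / 4) + K * expR b * \1_B w)%:E
   + (e / 4)%:E + (e / 4)%:E)).
  rewrite !leeD2r//; apply: ge0_le_integral => //.
  - by move=> w _; rewrite lee_fin.
  - apply/measurable_EFinP; apply: measurable_funM => //.
    apply: measurableT_comp => //.
    exact: (measurableT_comp (continuous_measurable_fun (@continuous_min_cst b)) mvX).
  - apply/measurable_EFinP; apply: measurable_funD.
      apply: measurable_funD => //; apply: measurable_funM => //.
      exact: measurableT_comp.
    by apply: measurable_funM => //; exact: measurable_indic.
  - move=> w _; rewrite lee_fin.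
    have fY0 := f0 (Y n w); have [_ fYK] := andP (fK (Y n w)).
    rewrite /g -/(Y n w).
    rewrite indicE; case: (boolP (w \in B)) => wB.
      rewrite mulr1.
      have : (f (Y n w) * expR (Num.min (v (Xi n w)) b) <= K * expR b)%R.
        by rewrite ler_pM ?expR_ge0// ler_expR ge_min lexx orbT.
      have : (0 <= f (Y n w) * expR (L n w))%R by rewrite mulr_ge0 ?expR_ge0.
      lra.
    rewrite mulr0 addr0.
    have Zdl : (`|Z w| <= dl)%R by rewrite leNgt; apply: contra wB => ?; exact: mem_set.
    have h1 := expR_min_lipschitz b (v (Xi n w)) (L n w).
    have h2 : (f (Y n w) * (expR b * `|L n w - v (Xi n w)|) <= e / 4)%R.
      apply: le_trans Kdl; rewrite -mulrA ler_pM ?mulr_ge0 ?expR_ge0//.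
      by rewrite ler_wpM2l ?expR_ge0.
    have h3 : (f (Y n w) * expR (Num.min (L n w) b) <= f (Y n w) * expR (L n w))%R.
      by rewrite ler_wpM2l// ler_expR ge_min lexx.
    have := ler_wpM2l fY0 h1; rewrite mulrDr; lra.
have mfe : measurable_fun setT (fun w => (f (Y n w) * expR (L n w))%:E).
  by apply/measurable_EFinP; apply: measurable_funM => //; exact: measurableT_comp.
under eq_integral do rewrite EFinD EFinD.
rewrite ge0_integralD//=; last 4 first.
- by move=> w _; rewrite adde_ge0// lee_fin ?(ltW e4)// mulr_ge0 ?expR_ge0.
- by apply: emeasurable_funD.
- by move=> w _; rewrite lee_fin !mulr_ge0 ?expR_ge0.
- by apply/measurable_EFinP; apply: measurable_funM => //; exact: measurable_indic.
rewrite ge0_integralD//=; last 2 first.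
- by move=> w _; rewrite lee_fin mulr_ge0 ?expR_ge0.
- by move=> w _; rewrite lee_fin (ltW e4).
have -> : \int[P0]__ (e / 4)%:E = (e / 4)%:E.
  by rewrite integral_cst//= probability_setT mule1.
under [X in _ + X + _ + _]eq_integral do rewrite EFinM.
rewrite ge0_integralZl//=; last 2 first.
- by apply/measurable_EFinP; exact: measurable_indic.
- by rewrite lee_fin mulr_ge0 ?expR_ge0.
rewrite integral_indic// setIT.
move: (\int[P0]_w (f (Y n w) * expR (L n w))%:E) => I0.
rewrite -!addeA leeD2l//.
apply: (@le_trans _ _ ((e / 4)%:E + ((e / 4)%:E + ((e / 4)%:E + (e / 4)%:E)))).
  rewrite leeD2l// leeD2r//.
  apply: (@le_trans _ _ ((K * expR b)%:E * dl%:E)); last by rewrite -EFinM lee_fin.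
  by rewrite lee_wpmul2l// lee_fin mulr_ge0 ?expR_ge0.
by rewrite -!EFinD lee_fin; lra.
Unshelve. all: end_near. Qed.

End ThirdLemma.

(** * Gaussian densities in the plane and in space *)

Section GaussianDensities.
Context (R : realType).

Lemma sqrt_expR (x : R) : 0 < x -> Num.sqrt x = expR (ln x / 2).
Proof. by move=> x0; rewrite -powR12_sqrt ?ltW// /powR gt_eqF// mulrC. Qed.

(** Writing the normalizing constant as an exponential reduces identities
    between products of Gaussian densities to field identities between
    exponents. *)
Lemma normal_pdf_expR (m v x : R) : 0 < v ->
  normal_pdf m (Num.sqrt v) x
  = expR (- ln (2 * pi) / 2 - ln v / 2 - (x - m) ^+ 2 / v / 2).
Proof.
move=> v0; have s0 : Num.sqrt v != 0 by rewrite gt_eqF// sqrtr_gt0.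
have tp0 : 0 < 2 * pi :> R by rewrite mulr_gt0// pi_gt0.
rewrite normal_pdfE// /normal_peak /normal_fun sqr_sqrtr ?ltW//.
have -> : v * pi *+ 2 = v * (2 * pi) by rewrite -mulr_natl; ring.
rewrite sqrt_expR ?mulr_gt0 ?pi_gt0// lnM ?posrE// -expRN -expRD; congr expR.
by rewrite -mulr_natl; field; rewrite gt_eqF.
Qed.

Lemma integral_affine_subst (G : R -> R) (u c : R) : 0 < c -> continuous G ->
  (forall x, 0 <= G x) ->
  (\int[lebesgue_measure]_x (G (u + c * x) * c)%:E
   = \int[lebesgue_measure]_x (G x)%:E)%E.
Proof.
move=> c0 cG G0.
pose F (x : R^o) : R^o := u + c *: x.
have F'E : F^`()%classic = cst c.
  apply/funext => x; rewrite /F derive1E deriveD// deriveZ// derive_cst add0r.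
  by rewrite derive_id [LHS]mulr1.
rewrite [RHS](@increasing_ge0_integration_by_substitutionT R F G)//.
- by apply: eq_integral => x _; rewrite F'E.
- by move=> x y xy; rewrite /F ltrD2l ltr_pM2l.
- by rewrite F'E => ?; exact: cvg_cst.
- by rewrite F'E; exact: is_cvg_cst.
- by rewrite F'E; exact: is_cvg_cst.
- have h : (c * x) @[x --> -oo] --> (-oo : set_system R) by apply: gt0_cvgMrNy.
  exact: (cvg_comp _ _ h (cvg_addrl_Ny u)).
- have h : (c * x) @[x --> +oo] --> (+oo : set_system R) by apply: gt0_cvgMry.
  exact: (cvg_comp _ _ h (cvg_addrl u)).
Qed.

Lemma mx2E (a b c e : R) : mx2 a b c e =
  \matrix_(i < 2, j < 2) (if i == 0 then if j == 0 then a else b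
                           else if j == 0 then c else e).
Proof.
have E (i j : 'I_(1 + 1)) :
    (block_mx a%:M b%:M c%:M e%:M : 'M[R]_(1 + 1, 1 + 1)) i j =
    if val i == 0%N then if val j == 0%N then a else b
    else if val j == 0%N then c else e.
  have [i' ->|i' ->] := split_ordP i; rewrite ord1;
    have [j' ->|j' ->] := split_ordP j; rewrite ord1;
    by rewrite ?(block_mxEul, block_mxEur, block_mxEdl, block_mxEdr) mxE eqxx mulr1n.
by apply/matrixP => i j; rewrite [RHS]mxE; exact: E.
Qed.

Lemma cvec2E (a b : R) : cvec2 a b = \col_(i < 2) (if i == 0 then a else b).
Proof.
have E (i : 'I_(1 + 1)) j : (col_mx a%:M b%:M : 'cV[R]_(1 + 1)) i j =
    if val i == 0%N then a else b.
  have [i' ->|i' ->] := split_ordP i; rewrite ord1 (ord1 j);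
    by rewrite ?(col_mxEu, col_mxEd) mxE eqxx mulr1n.
by apply/matrixP => i j; rewrite [RHS]mxE; exact: E.
Qed.

Lemma cvec2_eta (x : 'cV[R]_2) : cvec2 (x 0 0) (x 1 0) = x.
Proof.
rewrite cvec2E; apply/matrixP => i j; rewrite mxE (ord1 j).
by case: i => -[|[|//]] i2; congr (x _ _); exact: val_inj.
Qed.

Lemma det_mx2 (a b c e : R) : \det (mx2 a b c e) = a * e - b * c.
Proof.
rewrite (expand_det_row _ 0) !big_ord_recl !big_ord0 /cofactor !det_mx11 mx2E.
by rewrite !mxE /=; ring.
Qed.

Lemma gauss_logpdf_block m n (A : 'M[R]_m) (B : 'M[R]_n) x y :
  0 < \det A -> 0 < \det B ->
  gauss_logpdf (block_mx A 0 0 B) (col_mx x y) = gauss_logpdf A x + gauss_logpdf B y.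
Proof.
move=> A0 B0; rewrite /gauss_logpdf det_ublock [ln (\det A * _)]lnM ?posrE//.
have -> : invmx (block_mx A 0 0 B) = block_mx (invmx A) 0 0 (invmx B).
  by apply: invmx_block_diag; rewrite unitmxE det_ublock unitfE mulf_neq0// gt_eqF.
rewrite tr_col_mx mul_row_block !mulmx0 addr0 add0r mul_row_col [_ 0 0]mxE natrD.
by field.
Qed.

Lemma invmx_mx2 (a b c e : R) : a * e - b * c != 0 ->
  invmx (mx2 a b c e) = (a * e - b * c)^-1 *: mx2 e (- b) (- c) a.
Proof.
move=> D0; set B := RHS.
have SB : mx2 a b c e *m B = 1%:M.
  rewrite /B -scalemxAr; apply/matrixP => i j; rewrite mxE mx2E mx2E !mxE.
  rewrite !big_ord_recl !big_ord0 !mxE /=.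
  by case: i => -[|[|//]] i2; case: j => -[|[|//]] j2; rewrite /=; field.
have U : mx2 a b c e \in unitmx by rewrite unitmxE det_mx2 unitfE.
by rewrite -[LHS]mulmx1 -SB mulmxA mulVmx// mul1mx.
Qed.

Lemma gauss_logpdf_mx2 (p q r x y : R) (v := r - q ^+ 2 / p) : 0 < p -> 0 < v ->
  gauss_logpdf (mx2 p q q r) (cvec2 x y)
  = - ln (2 * pi) - ln p / 2 - ln v / 2 - x ^+ 2 / p / 2 - (y - q / p * x) ^+ 2 / v / 2.
Proof.
move=> p0 v0.
have pvE : p * r - q * q = p * v by rewrite /v; field; rewrite gt_eqF.
have pv0 : p * v != 0 by rewrite mulf_neq0// gt_eqF.
rewrite /gauss_logpdf det_mx2 invmx_mx2 ?pvE// [ln (p * v)]lnM ?posrE//.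
have -> : ((cvec2 x y)^T *m ((p * v)^-1 *: mx2 r (- q) (- q) p) *m cvec2 x y) 0 0 =
   x ^+ 2 / p + (y - q / p * x) ^+ 2 / v.
  rewrite -scalemxAr -scalemxAl mxE mx2E cvec2E !mxE !big_ord_recl !big_ord0.
  rewrite !mxE !big_ord_recl !big_ord0 !mxE /= /v; field.
  by rewrite (mulrC r) expr2 pvE pv0 gt_eqF.
by field; rewrite !gt_eqF.
Qed.

Lemma dotmul_cvec2 (a b : R) (x : 'cV[R]_2) :
  ((cvec2 a b)^T *m x) 0 0 = a * x 0 0 + b * x 1 0.
Proof.
rewrite cvec2E mxE !big_ord_recl !big_ord0 !mxE /= addr0.
by congr (_ + b * x _ _); exact: val_inj.
Qed.

Lemma quad_mx2 (p q r : R) (h : 'cV[R]_2) :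
  (h^T *m mx2 p q q r *m h) 0 0 =
  p * h 0 0 ^+ 2 + 2 * q * (h 0 0 * h 1 0) + r * h 1 0 ^+ 2.
Proof.
rewrite -(cvec2_eta h) mx2E cvec2E !mxE !big_ord_recl !big_ord0.
by rewrite !mxE !big_ord_recl !big_ord0 !mxE /=; ring.
Qed.

Lemma col_of_tuple2 (x y : R) : col_of_tuple [tuple x; y] = cvec2 x y.
Proof.
rewrite cvec2E; apply/matrixP => i j; rewrite !mxE.
by case: i => -[|[|//]] i2; rewrite /= (tnth_nth 0).
Qed.

Lemma cvec3E (a b c : R) :
  cvec3 a b c = \col_(i < 3) (if i == 0 then a else if i == 1 then b else c).
Proof.
have E (i : 'I_(2 + 1)) j : (col_mx (cvec2 a b) c%:M : 'cV[R]_(2 + 1)) i j =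
    if val i == 0%N then a else if val i == 1%N then b else c.
  have [i' ->|i' ->] := split_ordP i; rewrite (ord1 j) ?(col_mxEu, col_mxEd).
    by rewrite cvec2E mxE; case: i' => -[|[|//]].
  by rewrite (ord1 i') mxE eqxx mulr1n.
by apply/matrixP => i j; rewrite [RHS]mxE; exact: E.
Qed.

Lemma col_of_tuple3 (x y z : R) : col_of_tuple [tuple x; y; z] = cvec3 x y z.
Proof.
rewrite cvec3E; apply/matrixP => i j; rewrite !mxE.
by case: i => -[|[|[|//]]] i2; rewrite /= (tnth_nth 0).
Qed.

Section TwoDim.
Variables (p q r : R) (h : 'cV[R]_2).
Let v := r - q ^+ 2 / p.
Hypotheses (p0 : 0 < p) (v0 : 0 < v).
Let S := mx2 p q q r.

(** Under N(0, S) the coordinate x and the combination (y - (q / p) x) / sqrt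
    v are independent with variances p and 1; the exponential tilt by h shifts
    their means to the covariances of these variables with h.(x, y). *)
Lemma tilted_gauss_factor (x y : R) :
  expR ((h^T *m cvec2 x y) 0 0 - (h^T *m S *m h) 0 0 / 2)
    * expR (gauss_logpdf S (cvec2 x y))
  = normal_pdf ((h 0 0 + h 1 0 * (q / p)) * p) (Num.sqrt p) x
    * (normal_pdf (h 1 0 * Num.sqrt v) 1 (- (q / p) / Num.sqrt v * x + (Num.sqrt v)^-1 * y)
       * (Num.sqrt v)^-1).
Proof.
have s0 : 0 < Num.sqrt v by rewrite sqrtr_gt0.
have s2 : v = Num.sqrt v ^+ 2 by rewrite sqr_sqrtr// ltW.
have -> : (Num.sqrt v)^-1 = expR (- (ln v / 2)).
  by rewrite expRN -sqrt_expR.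
rewrite -{2}[1]sqrtr1 !normal_pdf_expR// ln1 gauss_logpdf_mx2// -!expRD; congr expR.
rewrite expRN -sqrt_expR// -/v.
rewrite quad_mx2 -{1}(cvec2_eta h) dotmul_cvec2 cvec2E !mxE/=.
have -> : r = v + q ^+ 2 / p by rewrite /v subrK.
(* Only sqrt v is left, as a variable s with v = s^2, for [field]. *)
move: (ln v) (Num.sqrt v) s0 s2 => lv s s0 ->.
by field; rewrite !gt_eqF.
Qed.

(** By [tilted_gauss_factor], an affine change of variable in the inner
    integral makes it independent of the outer variable. *)
Lemma gauss_integral_mx2 (f : R -> R) : continuous f -> (forall x, 0 <= f x) ->
  gauss_integral_Rn S (fun x =>
    f (((cvec2 (- (q / p) / Num.sqrt v) (Num.sqrt v)^-1)^T *m x) 0 0)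
    * expR ((h^T *m x) 0 0 - (h^T *m S *m h) 0 0 / 2))
  = (\int[normal_prob (h 1 0 * Num.sqrt v)%R 1]_x (f x)%:E)%E.
Proof.
move=> cf f0; rewrite /gauss_integral_Rn /=.
have mf := continuous_measurable_fun cf.
set m := h 1 0 * Num.sqrt v.
pose G x := f x * normal_pdf m 1 x.
have cG : continuous G.
  move=> x; apply: cvgM; first exact: cf.
  by apply: continuous_normal_pdf; exact: oner_neq0.
have G0 x : 0 <= G x by rewrite mulr_ge0// normal_pdf_ge0.
rewrite integral_normal_prob; last first.
  by split; [exact/measurable_EFinP|move=> x; rewrite lee_fin].
set J := RHS.
have JE : J = (\int[lebesgue_measure]_x (G x)%:E)%E by apply: eq_integral => x _.
have s0 : 0 < (Num.sqrt v)^-1 by rewrite invr_gt0 sqrtr_gt0.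
pose a := (h 0 0 + h 1 0 * (q / p)) * p.
transitivity (\int[lebesgue_measure]_x ((normal_pdf a (Num.sqrt p) x)%:E * J))%E; last first.
  rewrite ge0_integralZr//.
  - by rewrite integral_normal_pdf mul1e.
  - by apply/measurable_EFinP; exact: measurable_normal_pdf.
  - by move=> x _; rewrite lee_fin normal_pdf_ge0.
  - by rewrite JE; apply: integral_ge0 => x _; rewrite lee_fin.
apply: eq_integral => x _.
rewrite JE -(integral_affine_subst (- (q / p) / Num.sqrt v * x) s0 cG G0).
rewrite -ge0_integralZl_EFin//=.
- apply: eq_integral => y _; rewrite -EFinM; congr EFin.
  rewrite (_ : col_of_tuple _ = cvec2 x y); last first.
    by rewrite -col_of_tuple2; congr col_of_tuple; exact: val_inj.
  rewrite -mulrA tilted_gauss_factor dotmul_cvec2 cvec2E !mxE/= /G -/m; ring.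
- by move=> y _; rewrite lee_fin mulr_ge0 ?G0 ?(ltW s0).
- apply/measurable_EFinP; apply: measurable_funM => //.
  apply: (measurableT_comp (continuous_measurable_fun cG)).
  by apply: measurable_funD => //; apply: measurable_funM.
- exact: normal_pdf_ge0.
Qed.

End TwoDim.

Section BlockDiag.
Variables (A : 'M[R]_2) (s : R) (h : 'cV[R]_2) (h2 : R).
Hypotheses (A0 : 0 < \det A) (s0 : 0 < s).
Let S : 'M[R]_3 := block_mx A 0 0 (s%:M : 'M[R]_1).

Lemma gauss_logpdf_mx1 y : expR (gauss_logpdf (s%:M : 'M[R]_1) (y%:M)) = normal_pdf 0 (Num.sqrt s) y.
Proof.
rewrite normal_pdf_expR// /gauss_logpdf det_scalar1 invmx_scalar tr_scalar_mx.
rewrite -!scalar_mxM mxE eqxx /= !mulr1n; congr expR; field; exact: lt0r_neq0.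
Qed.

(** The last coordinate is independent of the others, and its tilted density
    still has mass 1. *)
Lemma gauss_integral_block (g : 'cV[R]_2 -> R) :
  (forall x, 0 <= g x) ->
  gauss_integral_Rn S (fun x => g (usubmx (x : 'cV[R]_(2 + 1)))
     * expR (h2 * x (2 : 'I_3) 0 - h2 ^+ 2 * s / 2))
  = gauss_integral_Rn A g.
Proof.
move=> g0; rewrite /gauss_integral_Rn /=.
apply: eq_integral => x _; apply: eq_integral => y _.
transitivity (\int[lebesgue_measure]_z
  ((g (cvec2 x y) * expR (gauss_logpdf A (cvec2 x y)))%:E
   * (normal_pdf (h2 * s) (Num.sqrt s) z)%:E))%E; last first.
  rewrite ge0_integralZl_EFin//=.
  - rewrite integral_normal_pdf mule1 (_ : col_of_tuple _ = cvec2 x y)//.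
    by rewrite -col_of_tuple2; congr col_of_tuple; exact: val_inj.
  - by move=> z _; rewrite lee_fin normal_pdf_ge0.
  - by apply/measurable_EFinP; exact: measurable_normal_pdf.
  - by rewrite mulr_ge0// expR_ge0.
apply: eq_integral => z _; rewrite -EFinM; congr EFin.
have -> : col_of_tuple [tuple of x :: [tuple of y :: [tuple of z :: [tuple]]]] = cvec3 x y z.
  by rewrite -col_of_tuple3; congr col_of_tuple; exact: val_inj.
have -> : usubmx (cvec3 x y z : 'cV[R]_(2 + 1)) = cvec2 x y by rewrite /cvec3 col_mxKu.
have -> : cvec3 x y z (2 : 'I_3) 0 = z by rewrite cvec3E mxE.
have -> : gauss_logpdf S (cvec3 x y z)
    = gauss_logpdf A (cvec2 x y) + gauss_logpdf (s%:M : 'M[R]_1) z%:M.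
  by apply: (@gauss_logpdf_block 2 1); rewrite ?det_scalar1.
rewrite expRD gauss_logpdf_mx1.
rewrite -!mulrA; congr (_ * _); rewrite mulrCA; congr (_ * _).
rewrite !normal_pdf_expR// -expRD; congr expR; field; exact: lt0r_neq0.
Qed.

End BlockDiag.

End GaussianDensities.

(** * Tails and quantiles of the normal law *)

Section NormalTails.
Context (R : realType).
Local Open Scope ereal_scope.
Local Notation mu := (@lebesgue_measure R).

(** The change of variable is available for continuous integrands, so it is
    performed on the ramps and then passed to the limit. *)
Lemma normal_prob_pos_shift (m z : R) :
  normal_prob m 1 [set x | 0 < x - z]%R = normal_prob 0%R 1 [set x | 0 < x + m - z]%R.
Proof.
have c1 : continuous (fun x : R => x - z)%R.
  by move=> x; apply: cvgB; [exact: cvg_id|exact: cvg_cst].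
have c2 : continuous (fun x : R => x + m - z)%R.
  move=> x; apply: cvgB; last exact: cvg_cst.
  by apply: cvgD; [exact: cvg_id|exact: cvg_cst].
have h1 := @cvg_integral_ramp R (normal_prob m 1) _ c1.
have h2 := @cvg_integral_ramp R (normal_prob 0%R 1) _ c2.
suff E : (fun k => \int[normal_prob m 1]_x (ramp k (x - z))%:E)
       = (fun k => \int[normal_prob 0%R 1]_x (ramp k (x + m - z))%:E).
  by rewrite E in h1; exact: (cvg_unique _ h1 h2).
apply/funext => k.
have mr (u : R -> R) : continuous u -> ge0_mfun (fun x => (ramp k (u x))%:E).
  move=> cu; split; last by move=> x; rewrite lee_fin ramp_ge0.
  apply/measurable_EFinP; apply: (measurableT_comp (continuous_measurable_fun (@continuous_ramp R k))).
  exact: continuous_measurable_fun.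
rewrite (integral_normal_prob _ _ (mr _ c1)) (integral_normal_prob _ _ (mr _ c2)).
pose G (x : R) := (ramp k (x - z) * normal_pdf m 1 x)%R.
have cr : continuous (ramp k \o (fun x : R => x - z)%R).
  by move=> x; apply: continuous_comp; [exact: c1|exact: continuous_ramp].
have cG : continuous G.
  move=> x; apply: cvgM; first exact: cr.
  by apply: continuous_normal_pdf; exact: oner_neq0.
have G0 x : (0 <= G x)%R by rewrite mulr_ge0 ?ramp_ge0 ?normal_pdf_ge0.
transitivity (\int[mu]_x (G x)%:E); first by [].
rewrite -(integral_affine_subst m (@ltr01 R) cG G0).
apply: eq_integral => x _; rewrite -EFinM /G mulr1 mul1r (addrC m); congr (_ * _)%:E.
by rewrite !normal_pdfE ?oner_neq0// /normal_fun subr0 addrK.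
Qed.

Lemma pos_itv (z : R) : [set x | 0 < x - z]%R = `]z, +oo[%classic.
Proof. by apply/seteqP; split => x /=; rewrite in_itv/= andbT subr_gt0. Qed.

Lemma normal_prob_tail_shift (m z : R) :
  normal_prob m 1 `]z, +oo[ = normal_prob 0%R 1 `](z - m)%R, +oo[.
Proof.
rewrite -!pos_itv normal_prob_pos_shift; congr (normal_prob _ _ _).
by apply/seteqP; split => x /=; rewrite opprB addrA addrAC.
Qed.

Lemma normal_prob_itvoc_le (x y : R) : (x <= y)%R ->
  normal_prob 0%R 1 `]x, y] <= (normal_peak 1 * (y - x))%:E.
Proof.
move=> xy; rewrite /normal_prob.
apply: (@le_trans _ _ (\int[mu]_(t in `]x, y]) (normal_peak 1)%:E)).
  apply: ge0_le_integral => //.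
  - by move=> t _; rewrite lee_fin normal_pdf_ge0.
  - by apply: measurable_funTS; apply/measurable_EFinP; exact: measurable_normal_pdf.
  - by move=> t _; rewrite lee_fin normal_pdf_ub// oner_neq0.
by rewrite integral_cst//= lebesgue_measure_itv/= lte_fin EFinM; case: ltP => // yx;
  rewrite (_ : x = y) ?subrr// ?mule0//; apply/le_anti; rewrite xy.
Qed.

Lemma normal_prob_itvoc_gt0 (x y : R) : (x < y)%R -> 0 < normal_prob 0%R 1 `]x, y].
Proof.
move=> xy.
(* On ]x, y], the square of a point is at most x^2 + y^2. *)
pose k := (normal_peak 1 * expR (- (x ^+ 2 + y ^+ 2) / (1 ^+ 2 *+ 2)))%R.
have k0 : (0 < k)%R by rewrite mulr_gt0 ?expR_gt0// normal_peak_gt0// oner_neq0.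
apply: (@lt_le_trans _ _ (\int[mu]_(t in `]x, y]) k%:E)).
  rewrite integral_cst//= lebesgue_measure_itv/= lte_fin xy -EFinD -EFinM lte_fin.
  by rewrite mulr_gt0// subr_gt0.
apply: ge0_le_integral => //.
- by move=> t _; rewrite lee_fin ltW.
- by apply: measurable_funTS; apply/measurable_EFinP; exact: measurable_normal_pdf.
move=> t /=; rewrite in_itv/= => /andP[xt ty].
rewrite lee_fin normal_pdfE ?oner_neq0// /normal_fun subr0 ler_wpM2l ?normal_peak_ge0//.
rewrite ler_expR ler_pM2r ?invr_gt0 ?expr1n// ?ltr0n// lerN2.
have [t0|t0] := leP 0%R t.
  have : (t ^+ 2 <= y ^+ 2)%R by rewrite ler_sqr ?nnegrE// (le_trans t0).
  have := sqr_ge0 x; lra.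
have : (t ^+ 2 <= x ^+ 2)%R.
  by rewrite -(sqrrN t) -(sqrrN x) ler_sqr ?nnegrE ?lerN2 ?oppr_ge0 ?ltW// (lt_trans xt).
have := sqr_ge0 y; lra.
Qed.

Lemma normal_prob_set1 (m x : R) : normal_prob m 1 [set x] = 0.
Proof.
have /null_content_dominatesP := normal_prob_dominates m (1 : R); apply => //.
exact: lebesgue_measure_set1.
Qed.

Lemma std_normal_cdfE (z : R) :
  (std_normal_cdf z)%:E = normal_prob 0%R 1 `]-oo, z].
Proof. by rewrite fineK// fin_num_measure. Qed.

Lemma std_normal_cdfB (x y : R) : (x <= y)%R ->
  (std_normal_cdf y)%:E = (std_normal_cdf x)%:E + normal_prob 0%R 1 `]x, y].
Proof.
move=> xy; rewrite !std_normal_cdfE -measureU//.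
  congr (normal_prob _ _ _); apply/seteqP; split => t /=; rewrite !in_itv/=.
    by move=> ty; case: (leP t x) => tx; [left|right].
  by case=> [/le_trans|/andP[_]//]; apply.
by rewrite -subset0 => t []/=; rewrite !in_itv/= leNgt => /negP + /andP[].
Qed.

(** The distribution function is Lipschitz because the density is bounded. *)
Lemma continuous_std_normal_cdf : continuous (@std_normal_cdf R).
Proof.
have lip (x y : R) : (x <= y)%R ->
   (`|std_normal_cdf x - std_normal_cdf y| <= normal_peak 1 * (y - x))%R.
  move=> xy; have := normal_prob_itvoc_le xy.
  have fin : normal_prob 0%R 1 `]x, y] \is a fin_num by rewrite fin_num_measure.
  have := std_normal_cdfB xy; rewrite -(fineK fin) -EFinD => -[->].
  rewrite lee_fin => h; rewrite opprD addNKr normrN ger0_norm//.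
  by apply: fine_ge0; exact: measure_ge0.
have p0 : (0 < normal_peak 1 :> R)%R by rewrite normal_peak_gt0// oner_neq0.
move=> x; apply/cvgrPdist_le => e e0.
have d0 : (0 < e / normal_peak 1)%R by rewrite divr_gt0.
near=> y.
have : (`|x - y| <= e / normal_peak 1)%R.
  by near: y; apply: cvgr_dist_le => //; exact: cvg_id.
rewrite ler_pdivlMr// mulrC => h; apply: le_trans h.
have [xy|yx] := leP x y.
  by rewrite (le_trans (lip _ _ xy))// ler_wpM2l ?(ltW p0)// distrC ler_norm.
by rewrite distrC (le_trans (lip _ _ (ltW yx)))// ler_wpM2l ?ler_norm ?(ltW p0).
Unshelve. all: end_near. Qed.

(** The identity as a random variable, to which the limits of distribution
    functions at infinity apply. *)
Let idTR : measurableTypeR R -> R := idfun.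

#[local] HB.instance Definition _ :=
  @isMeasurableFun.Build _ _ _ _ idTR (@measurable_id _ _ setT).

Lemma std_normal_cdf_quantile (p : R) : (0 < p < 1)%R ->
  std_normal_cdf (std_normal_quantile p) = p.
Proof.
move=> /andP[p0 p1].
suff : exists z : R, std_normal_cdf z = p.
  by move=> [z zp]; rewrite /std_normal_quantile; case: xgetP => [x _ //|/(_ z)].
pose X : {RV (normal_prob 0%R (1 : R)) >-> R} := idTR.
have cdfX : cdf X = EFin \o @std_normal_cdf R.
  by apply/funext => z; rewrite /= std_normal_cdfE.
have /fine_cvgP[_ /cvgr_ge cy] := cvg_cdfy1 X.
have /fine_cvgP[_ /cvgr_le cNy] := cvg_cdfNy0 X.
have [b cb] : exists b, (p <= std_normal_cdf b)%R.
  near (@pinfty_nbhs R) => b; exists b; near: b.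
  by have := cy _ p1; rewrite cdfX.
have [a ca] : exists a, (std_normal_cdf a <= p)%R.
  near (@ninfty_nbhs R) => a; exists a; near: a.
  by have := cNy _ p0; rewrite cdfX.
have [ab|ba] := leP a b.
  have [|c _ cp] := IVT ab (continuous_subspaceT continuous_std_normal_cdf) (v := p).
    by rewrite ge_min ca le_max cb orbT.
  by exists c.
have [|c _ cp] := IVT (ltW ba) (continuous_subspaceT continuous_std_normal_cdf) (v := p).
  by rewrite ge_min ca le_max cb orbT.
by exists c.
Unshelve. all: end_near. Qed.

Lemma normal_tail_quantile (a : R) : (0 < a < 1)%R ->
  normal_prob 0%R 1 `](std_normal_quantile (1 - a))%R, +oo[ = a%:E.
Proof.
move=> /andP[a0 a1].
rewrite (_ : `]_, +oo[%classic = ~` `]-oo, (std_normal_quantile (1 - a))%R]%classic).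
  have h := std_normal_cdfE (std_normal_quantile (1 - a)).
  rewrite std_normal_cdf_quantile in h; last by apply/andP; split; lra.
  by rewrite probability_setC// -[X in 1 - X]h -EFinD opprB addrC subrK.
by rewrite setCitvl.
Qed.

Lemma normal_tail_gt (m z : R) : (0 < m)%R ->
  normal_prob 0%R 1 `]z, +oo[ < normal_prob m 1 `]z, +oo[.
Proof.
move=> m0; rewrite (normal_prob_tail_shift m).
have zm : (z - m < z)%R by rewrite ltrBlDr ltrDl.
have E : normal_prob 0%R 1 `](z - m)%R, +oo[ =
    normal_prob 0%R 1 `](z - m)%R, z] + normal_prob 0%R 1 `]z, +oo[.
  rewrite -measureU//.
    congr (normal_prob _ _ _); apply/seteqP; split => t /=; rewrite !in_itv/= !andbT.
      by move=> ->; case: (leP t z) => tz; [left|right].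
    by case=> [/andP[]//|]; exact: lt_trans.
  by rewrite -subset0 => t []/=; rewrite !in_itv/= andbT leNgt => /andP[_ /negP +].
rewrite E.
by rewrite addeC lteDl ?fin_num_measure// normal_prob_itvoc_gt0.
Qed.

(** The two open half-lines at [z] have total limiting mass 1, so lower bounds
    for both of their probabilities determine the limits. *)
Lemma cvg_normal_tail d (T : measurableType d) (Q : nat -> probability T R)
    (Y : nat -> T -> R) (m z : R) : cvg_normal Q Y m 1 ->
  (fun n => Q n [set w | z < Y n w]%R) @ \oo --> normal_prob m 1 `]z, +oo[.
Proof.
move=> [mY cY].
have mU n : measurable [set w | z < Y n w]%R.
  have -> : [set w | z < Y n w]%R = setT `&` Y n @^-1` `]z, +oo[%classic.
    by rewrite setTI; apply/seteqP; split => x/=; rewrite in_itv/= andbT.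
  exact: mY.
have mL n : measurable [set w | Y n w < z]%R.
  have -> : [set w | Y n w < z]%R = setT `&` Y n @^-1` `]-oo, z[%classic.
    by rewrite setTI; apply/seteqP; split => x/=; rewrite in_itv/=.
  exact: mY.
have c1 : continuous (fun x : R => x - z)%R.
  by move=> x; apply: cvgB; [exact: cvg_id|exact: cvg_cst].
have c2 : continuous (fun x : R => z - x)%R.
  by move=> x; apply: cvgB; [exact: cvg_cst|exact: cvg_id].
have finU n : Q n [set w | z < Y n w]%R \is a fin_num by exact: fin_num_measure.
have finL n : Q n [set w | Y n w < z]%R \is a fin_num by exact: fin_num_measure.
have finN A : measurable A -> normal_prob m 1 A \is a fin_num by exact: fin_num_measure.
have sumN : normal_prob m 1 `]z, +oo[ + normal_prob m 1 `]-oo, z[ = 1.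
  rewrite -[RHS](probability_setT (normal_prob m (1 : R))).
  rewrite (_ : setT = (`]z, +oo[ `|` `]-oo, z[) `|` [set z]); last first.
    apply/esym/seteqP; split => // t _ /=; rewrite !in_itv/= andbT.
    by case: (ltgtP t z) => h; [left; right|left; left|right].
  rewrite measureU//; last 2 first.
  - by apply: measurableU.
  - rewrite -subset0 => t []/=; rewrite !in_itv/= andbT => + tz; rewrite tz ltxx.
    by case.
  rewrite [X in _ = _ + X]normal_prob_set1 adde0 measureU//.
  by rewrite -subset0 => t []/=; rewrite !in_itv/= andbT => /lt_trans h /h; rewrite ltxx.
have sumQ n : Q n [set w | z < Y n w]%R + Q n [set w | Y n w < z]%R <= 1.
  rewrite -measureU//; first exact: probability_le1 (measurableU _ _ (mU n) (mL n)).
  by rewrite -subset0 => t []/= /lt_trans h /h; rewrite ltxx.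
have lo e (e0 : (0 < e)%R) := portmanteau_open mY cY c1 e0.
have hi e (e0 : (0 < e)%R) := portmanteau_open mY cY c2 e0.
rewrite -(fineK (finN `]z, +oo[%classic _))//.
apply/fine_cvgP; split; first exact: nearW.
apply/cvgrPdist_le => e e0; near=> n.
have : normal_prob m 1 [set x | 0 < x - z]%R <= Q n [set w | 0 < Y n w - z]%R + e%:E.
  by near: n; exact: lo.
have : normal_prob m 1 [set x | 0 < z - x]%R <= Q n [set w | 0 < z - Y n w]%R + e%:E.
  by near: n; exact: hi.
have -> : [set x | 0 < z - x]%R = `]-oo, z[%classic.
  by apply/seteqP; split => x /=; rewrite in_itv/= subr_gt0.
have -> : [set w | 0 < z - Y n w]%R = [set w | Y n w < z]%R.
  by apply/seteqP; split => x /=; rewrite subr_gt0.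
have -> : [set w | 0 < Y n w - z]%R = [set w | z < Y n w]%R.
  by apply/seteqP; split => x /=; rewrite subr_gt0.
rewrite pos_itv.
move: sumN (sumQ n); rewrite /=.
rewrite -(fineK (finU n)) -(fineK (finL n)) -(fineK (finN `]z, +oo[%classic _))//.
rewrite -(fineK (finN `]-oo, z[%classic _))//.
rewrite -!EFinD !lee_fin => -[] h1 h2 h3 h4 /=.
by rewrite ler_norml; apply/andP; split; lra.
Unshelve. all: end_near. Qed.

End NormalTails.

(** * Locally asymptotically normal Gaussian experiments *)

Section Experiments.
Context (R : realType) d (T : measurableType d).

(** The ratio of the two densities is the exponential of the difference of the
    log-densities, which never vanishes. *)
Lemma gaussian_change_of_measure n (P0 P1 : probability T R) (S0 S1 : 'M[R]_n)
    (X : T -> n.-tuple R) : measurable_fun setT X ->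
  gaussian_vector P0 S0 X -> gaussian_vector P1 S1 X ->
  forall g : n.-tuple R -> R, measurable_fun setT g -> (forall t, 0 <= g t) ->
  (\int[P1]_w (g (X w))%:E
   = \int[P0]_w (g (X w) * expR (gauss_logpdf S1 (col_of_tuple (X w))
                               - gauss_logpdf S0 (col_of_tuple (X w))))%:E)%E.
Proof.
move=> mX G0 G1 g mg g0.
have md S : measurable_fun setT (fun t : n.-tuple R => expR (gauss_logpdf S (col_of_tuple t))).
  by apply: measurableT_comp => //; exact: measurable_gauss_logpdf.
have d0 (S : 'M[R]_n) (t : n.-tuple R) : 0 <= expR (gauss_logpdf S (col_of_tuple t)).
  exact: expR_ge0.
rewrite (integral_density_Rn mX (md S1) (d0 S1) G1 (g := EFin \o g)); last first.
  by split; [exact/measurable_EFinP|move=> t; rewrite lee_fin].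
pose g' t := g t * expR (gauss_logpdf S1 (col_of_tuple t) - gauss_logpdf S0 (col_of_tuple t)).
rewrite (integral_density_Rn mX (md S0) (d0 S0) G0 (g := EFin \o g')); last first.
  split; last by move=> t; rewrite lee_fin mulr_ge0 ?expR_ge0.
  apply/measurable_EFinP; apply: measurable_funM => //.
  by apply: measurableT_comp => //; apply: measurable_funB; exact: measurable_gauss_logpdf.
apply: eq_integral_Rn => t /=; rewrite -!EFinM; congr EFin.
by rewrite /g' -mulrA -expRD subrK.
Qed.

Context (p : nat) (Delta : nat -> R).
Variables (P : 'cV[R]_p.+2 -> probability T R) (D : forall n, T -> n.-tuple R).
Variable theta0 : 'cV[R]_p.+2.
Hypothesis mD : forall n, measurable_fun setT (@D n).

Lemma measurable_loglik n th : measurable_fun setT (loglik P D n th).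
Proof.
exact: (measurableT_comp (measurable_gauss_logpdf _) (@mD n)).
Qed.

Lemma Tstat_factors_through_data n : exists2 F : n.-tuple R -> R,
  measurable_fun setT F & Tstat Delta P D theta0 n = F \o @D n.
Proof.
pose sc i (x : n.-tuple R) : R := 'D_(delta_mx i 0 : 'cV[R]_p.+2)
  (fun th => gauss_logpdf (covariance_mx (P th) (@D n)) (col_of_tuple x)) theta0.
have msc i : measurable_fun setT (sc i) by exact: measurable_derive_gauss_logpdf.
pose L := logstep Delta n.
exists (fun x => 8 / (Num.sqrt 3 * theta0 0 0 ^+ 2) *
  ((sc 1 x + theta0 0 0 * L * sc 0 x) / (Num.sqrt (n%:R * Delta n) * L `^ (3 / 2))
   - theta0 0 0 / 2 * (sc 0 x / Num.sqrt (n%:R * Delta n * L)))); last by [].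
apply: measurable_funM => //; apply: measurable_funB.
  apply: measurable_funM => //; apply: measurable_funD; first exact: msc.
  by apply: measurable_funM; [exact: measurable_cst|exact: msc].
apply: measurable_funM; first exact: measurable_cst.
by apply: measurable_funM; [exact: msc|exact: measurable_cst].
Qed.

Variables (rinv : nat -> 'M[R]_p.+2) (Xi : nat -> T -> 'cV[R]_p.+2) (Gamma : 'M[R]_p.+2).
Variables (c : 'cV[R]_p.+2) (m : 'cV[R]_p.+2 -> R).
Let gaussian_data th n := gaussian_vector (P th) (covariance_mx (P th) (@D n)) (@D n).

Hypothesis lan : LAN P D theta0 rinv Xi Gamma.
Hypothesis gauss0 : forall n, gaussian_data theta0 n.
Hypothesis gauss_local : forall h, \forall n \near \oo,
  gaussian_data (local_param theta0 rinv h n) n.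
Hypothesis TstatE : forall n w, Tstat Delta P D theta0 n w = (c^T *m Xi n w) 0 0.
Hypothesis limE : forall h (f : R -> R), continuous f -> (forall x, 0 <= f x) ->
  gauss_integral_Rn Gamma (fun x => f ((c^T *m x) 0 0)
     * expR ((h^T *m x) 0 0 - (h^T *m Gamma *m h) 0 0 / 2))
  = (\int[normal_prob (m h) 1]_x (f x)%:E)%E.

(** Instance of [le_cam_third] in which the likelihood ratio between the laws
    of the data is exact, by [gaussian_change_of_measure]. *)
Lemma cvg_normal_local h :
  cvg_normal (fun n => P (local_param theta0 rinv h n)) (Tstat Delta P D theta0) (m h) 1.
Proof.
case: lan => lanL lanXi; split=> [n|f bf].
  have [F mF ->] := Tstat_factors_through_data n; exact: (measurableT_comp mF (@mD n)).
have TE n : Tstat Delta P D theta0 n = (fun w => (c^T *m Xi n w) 0 0).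
  by apply/funext => w; exact: TstatE.
under eq_fun do rewrite TE.
apply: (le_cam_third lanXi _ (lanL h) _ (limE h) bf).
  by move=> n; apply: measurable_funB; exact: measurable_loglik.
near=> n => f' cf' f'0.
have G1 : gaussian_data (local_param theta0 rinv h n) n.
  by near: n; exact: gauss_local.
have [F mF TF] := Tstat_factors_through_data n.
have XF w : (c^T *m Xi n w) 0 0 = F (D n w) by rewrite -TstatE TF.
under eq_integral do rewrite XF.
under [in RHS]eq_integral do rewrite XF.
exact: (gaussian_change_of_measure (@mD n) (@gauss0 n) G1
  (measurableT_comp (continuous_measurable_fun cf') mF) (fun t => f'0 _)).
Unshelve. all: end_near. Qed.

Lemma cvg_normal_null : m 0 = 0 ->
  cvg_normal (fun=> P theta0) (Tstat Delta P D theta0) 0 1.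
Proof.
move=> m0; have := cvg_normal_local 0; rewrite m0.
by rewrite (_ : (fun n => _) = fun=> P theta0)//; apply/funext => n;
  rewrite /local_param mulmx0 addr0.
Qed.

Lemma calibrated_one_sided_test (a : R) : m 0 = 0 ->
  (forall h : 'cV[R]_p.+2, 0 < h 1 0 -> 0 < m h) -> 0 < a < 1 ->
  one_sided_test P theta0 rinv (Tstat Delta P D theta0) (std_normal_quantile (1 - a)) a.
Proof.
move=> m0 m_gt0 a01; set z := std_normal_quantile _; split.
  have := cvg_normal_tail (z := z) (cvg_normal_null m0).
  by rewrite normal_tail_quantile.
move=> h h1; have tail_fin : normal_prob (m h) 1 `]z, +oo[%classic \is a fin_num.
  by rewrite fin_num_measure.
exists (fine (normal_prob (m h) 1 `]z, +oo[%classic)); last first.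
  by rewrite fineK//; exact: cvg_normal_tail (cvg_normal_local h).
rewrite -lte_fin fineK// -(normal_tail_quantile a01); exact: normal_tail_gt (m_gt0 _ h1).
Qed.

End Experiments.

(** * Information and rate matrices *)

Section EfficientInformation.
Context (R : realType).
Implicit Types p q r s : R.

Lemma efficient_info_mx2 p q r : 
  efficient_info (mx2 p q q r) 1 = r - q ^+ 2 / p.
Proof.
rewrite /efficient_info [row' _ _]mx11_scalar invmx_scalar.
rewrite mx2E !mxE !big_ord1 !mxE !big_ord1 !mxE /=.
by rewrite mulr1n expr2 mulrAC.
Qed.

Lemma block_mx2E p q r s :
  (block_mx (mx2 p q q r) 0 0 (s%:M : 'M[R]_1) : 'M[R]_3) =
  \matrix_(i < 3, j < 3)
    (if i == 0 then if j == 0 then p else if j == 1 then q else 0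
     else if i == 1 then if j == 0 then q else if j == 1 then r else 0
     else if j == 0 then 0 else if j == 1 then 0 else s).
Proof.
have E (i j : 'I_(2 + 1)) : (block_mx (mx2 p q q r) 0 0 s%:M : 'M[R]_(2 + 1)) i j =
    (if val i == 0%N then if val j == 0%N then p else if val j == 1%N then q else 0
     else if val i == 1%N then if val j == 0%N then q else if val j == 1%N then r else 0
     else if val j == 0%N then 0 else if val j == 1%N then 0 else s).
  have [i' ->|i' ->] := split_ordP i; have [j' ->|j' ->] := split_ordP j;
    rewrite ?(block_mxEul, block_mxEur, block_mxEdl, block_mxEdr) ?mx2E !mxE;
    rewrite ?(ord1 i') ?(ord1 j') ?eqxx ?mulr1n //.
  - by case: i' => -[|[|//]] ?; case: j' => -[|[|//]] ?.
  - by case: i' => -[|[|//]] ?.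
  - by case: j' => -[|[|//]] ?.
by apply/matrixP => i j; rewrite [RHS]mxE; exact: E.
Qed.

Lemma efficient_info_block p q r s : p != 0 -> s != 0 ->
  efficient_info (block_mx (mx2 p q q r) 0 0 (s%:M : 'M[R]_1) : 'M[R]_3) 1
  = r - q ^+ 2 / p.
Proof.
move=> p0 s0; rewrite /efficient_info block_mx2E.
set S := \matrix_(i, j) _.
have -> : row' 1 (col' 1 S) = mx2 p 0 0 s.
  rewrite mx2E; apply/matrixP => i j; rewrite !mxE.
  by case: i => -[|[|//]] ?; case: j => -[|[|//]] ?.
rewrite invmx_mx2 mul0r subr0 ?mulf_neq0// oppr0 mx2E !mxE.
rewrite !big_ord_recl !big_ord0 !mxE !big_ord_recl !big_ord0 !mxE /=.
by field; rewrite p0.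
Qed.

End EfficientInformation.

Section LocalParameters.
Context (R : realType) (Delta : nat -> R) (sigma : R).
Hypotheses (Delta_gt0 : forall n, 0 < Delta n) (Delta_cvg0 : Delta @ \oo --> (0 : R))
  (nDelta_cvg : (fun n => n%:R * Delta n) @ \oo --> +oo).

Lemma near_logstep_ge1 : \forall n \near \oo, 1 <= logstep Delta n.
Proof.
near=> n.
have Dn : Delta n < expR (-1).
  by near: n; apply: (cvgr_lt _ Delta_cvg0); exact: expR_gt0.
rewrite /logstep lnV ?posrE// lerNr.
by rewrite -ler_expR lnK ?posrE// ltW.
Unshelve. all: end_near. Qed.

Lemma cvg_sqrt_horizon : (fun n => (Num.sqrt (n%:R * Delta n))^-1) @ \oo --> (0 : R).
Proof.
apply/cvgr0Pnorm_le => e e0; near=> n.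
have h : (e ^- 2 <= n%:R * Delta n) by near: n; exact: (cvgry_ge nDelta_cvg).
rewrite ger0_norm ?invr_ge0// -[leRHS]invrK lef_pV2 ?posrE ?invr_gt0//.
  have -> : e^-1 = Num.sqrt (e ^- 2) by rewrite -exprVn sqrtr_sqr gtr0_norm ?invr_gt0.
  exact: ler_wsqrtr.
by rewrite sqrtr_gt0 (lt_le_trans _ h)// invr_gt0 exprn_gt0.
Unshelve. all: end_near. Qed.

(** Once [logstep] is at least 1, all entries are dominated by (n
    Delta_n)^(-1/2). *)
Lemma rinv_m_vanishes : exists a b : nat -> R,
  [/\ forall n, rinv_m Delta sigma n = mx2 (a n) (sigma * a n) 0 (b n),
      a @ \oo --> (0 : R) & b @ \oo --> (0 : R)].
Proof.
pose a n : R := (Num.sqrt (n%:R * Delta n * logstep Delta n))^-1.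
pose b n := (Num.sqrt (n%:R * Delta n))^-1 * (logstep Delta n `^ (3 / 2))^-1.
exists a, b; split => //.
  apply: (@squeeze_cvgr _ _ _ _ (cst 0) (fun n => (Num.sqrt (n%:R * Delta n))^-1));
    [|exact: cvg_cst|exact: cvg_sqrt_horizon].
  near=> n.
  have L1 : 1 <= logstep Delta n by near: n; exact: near_logstep_ge1.
  have h : 0 < n%:R * Delta n by near: n; exact: (cvgry_gt nDelta_cvg).
  rewrite /a invr_ge0 sqrtr_ge0/= lef_pV2 ?posrE ?sqrtr_gt0//.
    by rewrite ler_wsqrtr// ler_peMr// ltW.
  by rewrite mulr_gt0// (lt_le_trans ltr01).
apply: (@squeeze_cvgr _ _ _ _ (cst 0) (fun n => (Num.sqrt (n%:R * Delta n))^-1));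
  [|exact: cvg_cst|exact: cvg_sqrt_horizon].
near=> n.
have L1 : 1 <= logstep Delta n by near: n; exact: near_logstep_ge1.
rewrite /b mulr_ge0 ?invr_ge0 ?powR_ge0//= ler_piMr ?invr_ge0//.
have L0 : 0 < logstep Delta n by exact: lt_le_trans L1.
rewrite invf_le1 ?powR_gt0//.
by rewrite -[leLHS](powRr0 (logstep Delta n)) ler_powR.
Unshelve. all: end_near. Qed.

Lemma cvg_local_m (th0 h : 'cV[R]_2) i :
  (fun n => local_param th0 (rinv_m Delta sigma) h n i 0) @ \oo --> th0 i 0.
Proof.
have [a [b [rE a0 b0]]] := rinv_m_vanishes.
have cM (u : nat -> R) k : u @ \oo --> (0 : R) -> (fun n => u n * k) @ \oo --> (0 : R).
  by move=> u0; rewrite -(mul0r k); apply: cvgM => //; exact: cvg_cst.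
rewrite -[X in _ --> X]addr0; under eq_fun => n.
  rewrite /local_param mxE rE mx2E mxE !big_ord_recl big_ord0 !mxE addr0. over.
apply: cvgD; first exact: cvg_cst.
have := cM _ (h ord0 0 + sigma * h (lift ord0 ord0) 0) a0.
have := cM _ (h (lift ord0 ord0) 0) b0.
case: i => -[|[|//]] i2 /= B0 A0.
  by under eq_fun do rewrite (mulrC sigma) -mulrA -mulrDr.
by under eq_fun do rewrite mul0r add0r.
Qed.

(** Local parameters are eventually admissible, because the parameter set is
    open and the rates vanish. *)
Lemma near_param_m (th0 h : 'cV[R]_2) : param_m th0 ->
  \forall n \near \oo, param_m (local_param th0 (rinv_m Delta sigma) h n).
Proof.
move=> [s0 /andP[H0 H1]]; near=> n; split.
  by near: n; exact: (cvgr_gt _ (@cvg_local_m th0 h 0) _ s0).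
apply/andP; split; near: n.
  exact: (cvgr_gt _ (@cvg_local_m th0 h 1) _ H0).
exact: (cvgr_lt _ (@cvg_local_m th0 h 1) _ H1).
Unshelve. all: end_near. Qed.

Lemma col_mx21_entries (x : 'cV[R]_2) (y : 'cV[R]_1) : let z : 'cV[R]_3 := col_mx x y in
  [/\ z 0 0 = x 0 0, z 1 0 = x 1 0 & z (2 : 'I_3) 0 = y 0 0].
Proof.
have E (i : 'I_2) : (col_mx x y : 'cV[R]_(2 + 1)) (lshift 1 i) 0 = x i 0 by rewrite col_mxEu.
split; [rewrite -(E 0)|rewrite -(E 1)|].
- by congr (col_mx _ _ _ _); exact: val_inj.
- by congr (col_mx _ _ _ _); exact: val_inj.
have <- : (col_mx x y : 'cV[R]_(2 + 1)) (rshift 2 0) 0 = y 0 0 by rewrite col_mxEd.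
by congr (col_mx _ _ _ _); exact: val_inj.
Qed.

Lemma near_param_o (th0 : 'cV[R]_2) (alpha : R) (h : 'cV[R]_3) : param_m th0 -> 0 < alpha ->
  \forall n \near \oo,
    param_o (local_param (col_mx th0 (alpha%:M : 'M[R]_1) : 'cV[R]_3) (rinv_o Delta sigma) h n).
Proof.
move=> th0P al0.
pose h' := usubmx (h : 'cV[R]_(2 + 1)); pose h2 := dsubmx (h : 'cV[R]_(2 + 1)).
pose k n : R := (Num.sqrt (n%:R * Delta n))^-1.
have lE n : local_param (col_mx th0 (alpha%:M : 'M[R]_1) : 'cV[R]_3) (rinv_o Delta sigma) h n
    = col_mx (local_param th0 (rinv_m Delta sigma) h' n) (alpha%:M + (k n)%:M *m h2).
  rewrite /local_param -{1}(vsubmxK (h : 'cV[R]_(2 + 1))) /rinv_o.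
  by rewrite (@mul_block_col _ 2 1 2 1) !mul0mx addr0 add0r (@add_col_mx _ 2 1).
have cal : (fun n => alpha + k n * h2 0 0) @ \oo --> alpha.
  rewrite -[X in _ --> X]addr0; apply: cvgD; first exact: cvg_cst.
  by rewrite -(mul0r (h2 0 0)); apply: cvgM; [exact: cvg_sqrt_horizon|exact: cvg_cst].
near=> n; rewrite lE.
have [x0 x1 x2] := col_mx21_entries (local_param th0 (rinv_m Delta sigma) h' n)
  (alpha%:M + (k n)%:M *m h2).
have [s0 H01] : param_m (local_param th0 (rinv_m Delta sigma) h' n).
  by near: n; exact: near_param_m.
have al : 0 < alpha + k n * h2 0 0 by near: n; exact: (cvgr_gt _ cal _ al0).
split; rewrite ?x0 ?x1 ?x2//.
by rewrite mul_scalar_mx mxE [X in X + _]mxE [X in _ + X]mxE mulr1n.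
Unshelve. all: end_near. Qed.

End LocalParameters.

Section LimitingExperiments.
Context (R : realType) (p q r s : R).
Let v := r - q ^+ 2 / p.
Hypotheses (p0 : 0 < p) (v0 : 0 < v) (s0 : 0 < s).
Let c2 := cvec2 (- (q / p) / Num.sqrt v) (Num.sqrt v)^-1.

Lemma gauss_integral_block_mx2 (h : 'cV[R]_3) (f : R -> R) :
  continuous f -> (forall x, 0 <= f x) ->
  let S : 'M[R]_3 := block_mx (mx2 p q q r) 0 0 (s%:M : 'M[R]_1) in
  gauss_integral_Rn S (fun x => f (((col_mx c2 (0 : 'M[R]_1) : 'cV[R]_3)^T *m x) 0 0)
     * expR ((h^T *m x) 0 0 - (h^T *m S *m h) 0 0 / 2))
  = (\int[normal_prob (h 1 0 * Num.sqrt v)%R 1]_x (f x)%:E)%E.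
Proof.
move=> cf f0 S.
pose h' := usubmx (h : 'cV[R]_(2 + 1)); pose h2 := dsubmx (h : 'cV[R]_(2 + 1)) 0 0.
have [_ h1 _] := col_mx21_entries h' (dsubmx (h : 'cV[R]_(2 + 1))).
rewrite (vsubmxK (h : 'cV[R]_(2 + 1))) in h1; rewrite h1.
have A0 : 0 < \det (mx2 p q q r).
  by rewrite det_mx2 (_ : _ - _ = p * v) ?mulr_gt0// /v; field; rewrite gt_eqF.
rewrite -(gauss_integral_mx2 h' p0 v0 cf f0) -(gauss_integral_block h2 A0 s0); last first.
  by move=> x; rewrite mulr_ge0 ?expR_ge0.
congr gauss_integral_Rn; apply/funext => x; rewrite -mulrA -expRD.
have [_ _ x2] := col_mx21_entries (usubmx (x : 'cV[R]_(2 + 1))) (dsubmx (x : 'cV[R]_(2 + 1))).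
rewrite (vsubmxK (x : 'cV[R]_(2 + 1))) in x2; rewrite x2.
have dot (y : 'cV[R]_2) (z : 'M[R]_1) : ((col_mx y z : 'cV[R]_3)^T *m x) 0 0
   = (y^T *m usubmx (x : 'cV[R]_(2 + 1))) 0 0 + z 0 0 * dsubmx (x : 'cV[R]_(2 + 1)) 0 0.
  rewrite -{1}(vsubmxK (x : 'cV[R]_(2 + 1))) (@tr_col_mx _ 2 1) (@mul_row_col _ _ 2 1) mxE.
  by congr (_ + _); rewrite !mxE big_ord1 !mxE.
rewrite dot [X in _ + X * _]mxE mul0r addr0; congr (f _ * expR _).
have -> : (h^T *m S *m h) 0 0 = (h'^T *m mx2 p q q r *m h') 0 0 + h2 ^+ 2 * s.
  rewrite -(vsubmxK (h : 'cV[R]_(2 + 1))) (@tr_col_mx _ 2 1) (@mul_row_block _ _ 2 1 2 1).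
  rewrite !mulmx0 addr0 add0r (@mul_row_col _ _ 2 1) mxE; congr (_ + _).
  by rewrite mul_mx_scalar /h2 !mxE big_ord1 !mxE; ring.
rewrite -[h in LHS](vsubmxK (h : 'cV[R]_(2 + 1))) dot -/h' -/h2; by field.
Qed.

End LimitingExperiments.

(** * The critical mixed fractional models *)

Section CriticalStatistic.
Context (R : realType) (sigma : R) (sigma_gt0 : 0 < sigma).

(** The efficient information, in the unsimplified form r - q^2 / p under
    which it occurs in [gauss_integral_mx2] and [efficient_info_mx2]. *)
Definition crit_info : R := 3 * sigma ^+ 4 / 16 - (9 * sigma ^+ 3 / 32) ^+ 2 / (9 * sigma ^+ 2 / 16).

Lemma crit_infoE : crit_info = 3 * sigma ^+ 4 / 64.
Proof. by rewrite /crit_info; field; rewrite gt_eqF. Qed.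

Lemma crit_info_gt0 : 0 < crit_info.
Proof. by rewrite crit_infoE !mulr_gt0 ?exprn_gt0 ?invr_gt0. Qed.

Lemma sqrt_crit_info : Num.sqrt crit_info = Num.sqrt 3 * sigma ^+ 2 / 8.
Proof.
rewrite crit_infoE (_ : _ / 64 = 3 * (sigma ^+ 2 / 8) ^+ 2); last by field.
by rewrite sqrtrM// sqrtr_sqr ger0_norm ?mulrA// divr_ge0// sqr_ge0.
Qed.

(** The direction c for which c.x is the normalized residual of x_H regressed
    on x_sigma. *)
Definition crit_dir : 'cV[R]_2 :=
  cvec2 (- (9 * sigma ^+ 3 / 32 / (9 * sigma ^+ 2 / 16)) / Num.sqrt crit_info)
        (Num.sqrt crit_info)^-1.

Lemma crit_dir_dot (x y : R) : (crit_dir^T *m cvec2 x y) 0 0 =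
  8 / (Num.sqrt 3 * sigma ^+ 2) * (y - sigma / 2 * x).
Proof.
rewrite /crit_dir dotmul_cvec2 sqrt_crit_info cvec2E !mxE /=.
by field; rewrite !gt_eqF// sqrtr_gt0.
Qed.

End CriticalStatistic.

Lemma measurable_mfBm_data (R : realType) d (T : measurableType d) (Delta : nat -> R)
  (Y : R -> {mfun T >-> R}) n : measurable_fun setT (mfBm_data Delta Y n).
Proof.
apply/measurable_fun_tnthP => i.
rewrite (_ : _ \o _ = fun w => Y (i.+1%:R * Delta n) w - Y (i%:R * Delta n) w).
  exact: measurable_funB.
by apply/funext => w; rewrite /= tnth_mktuple.
Qed.

Lemma measurable_mfOU_data (R : realType) d (T : measurableType d) (Delta : nat -> R)
  (X : R -> {mfun T >-> R}) n : measurable_fun setT (mfOU_data Delta X n).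
Proof.
apply/measurable_fun_tnthP => i.
rewrite (_ : _ \o _ = fun w => X (i.+1%:R * Delta n) w)//.
by apply/funext => w; rewrite /= tnth_mktuple.
Qed.

Theorem corollary17 (R : realType)
  (d1 : measure_display) (Tm : measurableType d1)
  (d2 : measure_display) (To : measurableType d2)
  (Delta : nat -> R) (sigma alpha : R)
  (Pm : 'cV[R]_2 -> probability Tm R) (Y : R -> {mfun Tm >-> R})
  (Po : 'cV[R]_3 -> probability To R) (X : R -> {mfun To >-> R})
  (Delta_gt0 : forall n, 0 < Delta n)
  (Delta_noninc : nonincreasing_seq Delta)
  (Delta_cvg0 : Delta @ \oo --> (0 : R))
  (nDelta_cvg : (fun n => n%:R * Delta n) @ \oo --> +oo)
  (sigma_gt0 : 0 < sigma) (alpha_gt0 : 0 < alpha)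
  (model_m : mfBm_model Delta Pm Y)
  (model_o : mfOU_model Delta Po X) :
  let thm := cvec2 sigma (3 / 4) in
  let tho := cvec3 sigma (3 / 4) alpha in
  let Dm := mfBm_data Delta Y in
  let Do := mfOU_data Delta X in
  let rm := rinv_m Delta sigma in
  let ro := rinv_o Delta sigma in
  let Gm := Gamma_m sigma in
  let Go := Gamma_o sigma alpha in
  let Tstat_m := Tstat Delta Pm Dm thm in
  let Tstat_o := Tstat Delta Po Do tho in
  let Im := efficient_info Gm 1 in
  let Io := efficient_info Go 1 in
  LAN Pm Dm thm rm (Xi_m Delta Pm Y thm) Gm ->
  LAN Po Do tho ro (Xi_o Delta Po X tho) Go ->
  [/\ (* efficient informations *)
      Im = 3 * sigma ^+ 4 / 64 /\ Io = 3 * sigma ^+ 4 / 64,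
      (* critical null hypothesis *)
      cvg_normal (fun=> Pm thm) Tstat_m 0 1 /\
      cvg_normal (fun=> Po tho) Tstat_o 0 1,
      (* local alternatives *)
      (forall h : 'cV[R]_2, 0 < h 1 0 ->
        cvg_normal (fun n => Pm (local_param thm rm h n)) Tstat_m
          (h 1 0 * Num.sqrt Im) 1) /\
      (forall h : 'cV[R]_3, 0 < h 1 0 ->
        cvg_normal (fun n => Po (local_param tho ro h n)) Tstat_o
          (h 1 0 * Num.sqrt Io) 1) &
      (* boundary-calibrated one-sided tests of H <= 3/4 against H > 3/4 *)
      forall a : R, 0 < a < 1 ->
        one_sided_test Pm thm rm Tstat_m (std_normal_quantile (1 - a)) a /\
        one_sided_test Po tho ro Tstat_o (std_normal_quantile (1 - a)) a].
Proof.
move=> thm tho Dm Do rm ro Gm Go Tstat_m Tstat_o Im Io lan_m lan_o.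
have p0 : 0 < 9 * sigma ^+ 2 / 16 by rewrite !mulr_gt0 ?exprn_gt0 ?invr_gt0.
have v0 := crit_info_gt0 sigma_gt0.
have s0 : 0 < 1 / (2 * alpha) by rewrite divr_gt0// mulr_gt0.
have ImE : Im = crit_info sigma by exact: efficient_info_mx2.
have IoE : Io = crit_info sigma by apply: efficient_info_block; rewrite gt_eqF.
have thm_s : thm 0 0 = sigma by rewrite /thm cvec2E mxE.
have tho_s : tho 0 0 = sigma by rewrite /tho cvec3E mxE.
have pm : param_m thm.
  by split; rewrite /thm cvec2E !mxE//=; apply/andP; split; lra.
have po : param_o tho.
  by split; rewrite /tho cvec3E !mxE//=; apply/andP; split; lra.
have gml h : \forall n \near \oo, gaussian_vector (Pm (local_param thm rm h n))
    (covariance_mx (Pm (local_param thm rm h n)) (@Dm n)) (@Dm n).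
  apply: filterS (near_param_m sigma Delta_gt0 Delta_cvg0 nDelta_cvg h pm) => n pn.
  exact: (model_m _ pn).2.
have gol h : \forall n \near \oo, gaussian_vector (Po (local_param tho ro h n))
    (covariance_mx (Po (local_param tho ro h n)) (@Do n)) (@Do n).
  have := near_param_o sigma Delta_gt0 Delta_cvg0 nDelta_cvg h pm alpha_gt0.
  apply: filterS => n pn; exact: (model_o _ pn).2.
have TmE n w : Tstat_m n w = ((crit_dir sigma)^T *m Xi_m Delta Pm Y thm n w) 0 0.
  by rewrite /Xi_m crit_dir_dot// /Tstat_m /Tstat thm_s.
have ToE n w : Tstat_o n w = ((col_mx (crit_dir sigma) (0 : 'M[R]_1) : 'cV[R]_3)^T
     *m Xi_o Delta Po X tho n w) 0 0.
  rewrite /Xi_o /cvec3 (@tr_col_mx _ 2 1) (@mul_row_col _ _ 2 1) trmx0 mul0mx addr0.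
  by rewrite crit_dir_dot// /Tstat_o /Tstat tho_s.
pose mean k (h : 'cV[R]_k.+2) := h 1 0 * Num.sqrt (crit_info sigma).
have mean0 k : mean k 0 = 0 by rewrite /mean mxE mul0r.
have mean_gt0 k (h : 'cV[R]_k.+2) : 0 < h 1 0 -> 0 < mean k h.
  by move=> h1; rewrite mulr_gt0 ?sqrtr_gt0.
have mDm := measurable_mfBm_data Delta Y.
have mDo := measurable_mfOU_data Delta X.
have gm0 := (model_m _ pm).2.
have go0 := (model_o _ po).2.
have limm h f cf f0 : _ = (\int[normal_prob (mean 0%N h) 1]_x (f x)%:E)%E :=
  @gauss_integral_mx2 R _ _ _ h p0 v0 f cf f0.
have limo h f cf f0 : _ = (\int[normal_prob (mean 1%N h) 1]_x (f x)%:E)%E :=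
  @gauss_integral_block_mx2 R _ _ _ _ p0 v0 s0 h f cf f0.
rewrite ImE IoE; split; first by rewrite crit_infoE.
- split; [exact: (cvg_normal_null mDm lan_m gm0 gml TmE limm (mean0 0%N))
         |exact: (cvg_normal_null mDo lan_o go0 gol ToE limo (mean0 1%N))].
- split=> h _; [exact: (cvg_normal_local mDm lan_m gm0 gml TmE limm h)
               |exact: (cvg_normal_local mDo lan_o go0 gol ToE limo h)].
- move=> a a01; split.
    exact: (calibrated_one_sided_test mDm lan_m gm0 gml TmE limm (mean0 0%N) (@mean_gt0 0%N) a01).
  exact: (calibrated_one_sided_test mDo lan_o go0 gol ToE limo (mean0 1%N) (@mean_gt0 1%N) a01).
Qed.
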